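(* Let $X$ be a locally compact Hausdorff space, $\mathcal{A}$ a unital $C^*$-algebra, and $\mathcal{E}$ a $*$-subalgebra of $C_0(X,\mathcal{A})$ such that: (AX0) if $X$ is noncompact, then for each $z\in X$ either $f_0(z)$ is invertible in $\mathcal{A}$ for some $f_0\in\mathcal{E}$, or $f(z)=0$ for all $f\in\mathcal{E}$; and for any two points $x,y\in X$ one of the following holds: (AX1) $x$ and $y$ are spectrally separated by $\mathcal{E}$; or (AX2) $M(f(x))=M(f(y))$ for every selfadjoint $f\in\mathcal{E}$. Then the uniform closure of $\mathcal{E}$ in $C_0(X,\mathcal{A})$ coincides with the $*$-algebra $\Delta_2(\mathcal{E})$ of all $u\in C_0(X,\mathcal{A})$ such that for any $x,y\in X$ and each $\varepsilon>0$ there is $v\in\mathcal{E}$ with $\|v(z)-u(z)\|<\varepsilon$ for $z\in\{x,y\}$.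
   Context: $C_0(X,\mathcal{A})$ denotes the $C^*$-algebra (pointwise operations, supremum norm) of continuous $f\colon X\to\mathcal{A}$ vanishing at infinity (for every $\varepsilon>0$ there is a compact $K$ with $\|f(x)\|<\varepsilon$ off $K$). For a selfadjoint $a\in\mathcal{A}$, $M(a)=\max\sigma(a)$. A collection $\mathcal{F}$ of functions $X\to\mathcal{A}$ spectrally separates distinct points $x,y$ if there is $f\in\mathcal{F}$ such that $f(x),f(y)$ are normal and $\sigma(f(x))\cap\sigma(f(y))=\emptyset$. *)

(* Defs.v *)
(* MathComp-Analysis (topology, reals) + real_closed (complex numbers R[i]). *)
From HB Require Import structures.
From mathcomp Require Import all_boot all_order all_algebra.
From mathcomp Require Import all_classical all_reals.
From mathcomp Require Import topology.
From mathcomp Require Import complex.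
Set Implicit Arguments.
Unset Strict Implicit.
Unset Printing Implicit Defensive.
Import Order.TTheory GRing.Theory Num.Theory.
Local Open Scope ring_scope.
Local Open Scope classical_set_scope.

(* The complex field over a real field R is R[i]; scalars of the C*-algebra. *)

Section CStar.
Variables (R : realType) (A : algType R[i]).
Variables (nrm : A -> R) (star : A -> A).

(* a is invertible in the unital algebra A *)
Definition invertible (a : A) : Prop := exists b : A, a * b = 1 /\ b * a = 1.

(* spectrum sigma(a) = { lambda in C | a - lambda 1 is not invertible } *)
Definition spectrum (a : A) : set R[i] :=
  [set l : R[i] | ~ invertible (a - l%:A)].

Definition normal (a : A) : Prop := a * star a = star a * a.
Definition selfadjoint (a : A) : Prop := star a = a.

(* M(a) = max sigma(a) for selfadjoint a (sigma(a) is then a nonempty compact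
   subset of the real line, so its maximum is the supremum of the real parts) *)
Definition Mspec (a : A) : R := sup [set @complex.Re R l | l in spectrum a].

(* (A, nrm, star) is a unital C*-algebra over the complex numbers R[i] *)
Record unital_cstar_algebra : Prop := {
  nrm_ge0 : forall a, 0 <= nrm a;
  nrm_eq0 : forall a, nrm a = 0 -> a = 0;
  nrm_triangle : forall a b, nrm (a + b) <= nrm a + nrm b;
  nrm_scale : forall (c : R[i]) a, ((nrm (c *: a))%:C = `|c| * (nrm a)%:C)%C;
  nrm_submult : forall a b, nrm (a * b) <= nrm a * nrm b;
  nrm_one : nrm 1 = 1;
  nrm_complete : forall u : nat -> A,
    (forall e : R, 0 < e -> exists N : nat, forall n m : nat,
        (N <= n)%N -> (N <= m)%N -> nrm (u n - u m) < e) ->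
    exists l : A, forall e : R, 0 < e -> exists N : nat, forall n : nat,
        (N <= n)%N -> nrm (u n - l) < e;
  star_add : forall a b, star (a + b) = star a + star b;
  star_scale : forall (c : R[i]) a, star (c *: a) = (c^*)%C *: star a;
  star_mul : forall a b, star (a * b) = star b * star a;
  star_invol : forall a, star (star a) = a;
  cstar_identity : forall a, nrm (star a * a) = nrm a ^+ 2
}.

Section Functions.
Variable (X : topologicalType).

(* C_0(X, A): continuous functions vanishing at infinity *)
Definition C0 (f : X -> A) : Prop :=
  (forall (x : X) (e : R), 0 < e -> \forall y \near x, nrm (f y - f x) < e) /\
  (forall e : R, 0 < e -> exists K : set X, compact K /\
      forall x : X, ~ K x -> nrm (f x) < e).

(* E is a *-subalgebra of C_0(X, A) *)
Definition star_subalgebra (E : set (X -> A)) : Prop :=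
  E `<=` C0 /\ E (fun _ => 0) /\
  (forall f g, E f -> E g -> E (fun x => f x + g x)) /\
  (forall (c : R[i]) f, E f -> E (fun x => c *: f x)) /\
  (forall f g, E f -> E g -> E (fun x => f x * g x)) /\
  (forall f, E f -> E (fun x => star (f x))).

Definition spectrally_separates (E : set (X -> A)) (x y : X) : Prop :=
  exists f, E f /\ normal (f x) /\ normal (f y) /\
    spectrum (f x) `&` spectrum (f y) = set0.

(* uniform (sup-norm) closure of E in C_0(X, A) *)
Definition uniform_closure (E : set (X -> A)) : set (X -> A) :=
  [set u | C0 u /\ forall e : R, 0 < e ->
     exists v, E v /\ forall z : X, nrm (v z - u z) < e].

(* Delta_2(E) *)
Definition Delta2 (E : set (X -> A)) : set (X -> A) :=
  [set u | C0 u /\ forall (x y : X) (e : R), 0 < e ->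
     exists v, E v /\ nrm (v x - u x) < e /\ nrm (v y - u y) < e].

End Functions.
End CStar.

(* Main.v *)
(* Let Y be X, or its one-point compactification when X is not compact; in the
   latter case (AX0) makes every point comparable with the point at infinity.

   If (AX2) holds for x and y, then |v x| = |v y| for all selfadjoint v in E, since
   |a| = max(M(a), M(-a)). If f spectrally separates x and y, a grid of tent functions
   of the real and imaginary parts of f yields a multiplier h of the closure of E with
   h x = 1 and h y = 0: on each small cell, the product of tents vanishes at f x or at
   f y, because the centre of the cell lies outside one of the two spectra.

   By compactness such multipliers give Urysohn functions, bounded in norm but with
   noncommuting values. Nevertheless, a continuous function m : Y -> [0, 1] that
   distinguishes only spectrally separated points is a multiplier: the mean of
   Urysohn functions for the n layers of m is within 2/n of the scalar m.

   Finally, given u in Delta_2(E), finitely many v_i in E satisfy |v_i - u| < e on sets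
   covering Y. Measuring real and imaginary parts separately, the functions |v_i - u|
   take equal values at x and y under (AX2), so a partition of unity (m_i) built from
   them consists of multipliers, and sum_i m_i v_i approximates u. *)

Require Import Defs.
From Stdlib Require List.
From HB Require Import structures.
From mathcomp Require Import all_boot all_order all_algebra.
From mathcomp Require Import all_classical all_reals.
From mathcomp Require Import topology normedtype sequences.
From mathcomp Require Import complex.
From mathcomp Require Import ring lra.
Import Order.TTheory GRing.Theory Num.Theory.
Import numFieldNormedType.Exports.
Local Open Scope ring_scope.
Local Open Scope classical_set_scope.

(** If [P K] failed, the sets whose complement in [K] satisfies [P] would form a proper filter
    containing [K]. At a cluster point in [K], a neighbourhood [U] with [P U] would have to meet its
    own complement. This form of compactness replaces finite subcovers throughout. *)
Lemma compact_ind (T : topologicalType) (K : set T) (P : set T -> Prop) :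
  compact K -> P set0 ->
  (forall S S', S `<=` S' -> P S' -> P S) ->
  (forall S S', P S -> P S' -> P (S `|` S')) ->
  (forall x, K x -> exists2 U, nbhs x U & P U) -> P K.
Proof.
move=> cK P0 Psub PU Ploc; apply: contrapT => nPK.
pose F : set_system T := [set S | P (K `&` ~` S)].
have FF : ProperFilter F.
  split; first by rewrite /F/= setC0 setIT.
  split.
  - by rewrite /F/= setCT setI0.
  - move=> S S' FS FS'; have := PU _ _ FS FS'.
    by apply: Psub => x [Kx /not_andP[]]; [left|right].
  - by move=> S S' SS'; apply: Psub; apply: setIS; exact: subsetC.
have [|x [Kx clx]] := cK F FF; first by rewrite /F/= setICr.
have [U xU PUU] := Ploc x Kx.
have [||y []//] := clx (~` U) U; last by [].
by rewrite /F/= setCK; apply: Psub PUU => y [].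
Qed.

Section CstarTheory.
Variables (R : realType) (A : algType R[i]) (nrm : A -> R) (star : A -> A).
Hypothesis cstar : unital_cstar_algebra nrm star.
Implicit Types (a b : A) (l : R[i]).
Local Notation normc := ComplexField.Normc.normc.
Local Notation "x %:C" := (real_complex R x) : ring_scope.

(** * Norm, invertibility and spectrum *)

Definition inverse_of a b := a * b = 1 /\ b * a = 1.

Lemma nrmZ l a : nrm (l *: a) = normc l * nrm a.
Proof. by have := nrm_scale cstar l a; rewrite /Num.norm/= -rmorphM => /complexI. Qed.

Lemma normc_real (r : R) : normc r%:C = `|r|.
Proof. by rewrite /= expr0n/= addr0 sqrtr_sqr. Qed.

Lemma normc_ge0 l : 0 <= normc l.
Proof. by case: l => x y; exact: sqrtr_ge0. Qed.

Lemma nrmZr (r : R) a : nrm (r%:C *: a) = `|r| * nrm a.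
Proof. by rewrite nrmZ normc_real. Qed.

Lemma nrm0 : nrm 0 = 0.
Proof. by rewrite -(scale0r (0 : A)) nrmZ ComplexField.Normc.normc0 mul0r. Qed.

Lemma nrmN a : nrm (- a) = nrm a.
Proof.
by rewrite -scaleN1r -(rmorph1 (real_complex R)) -rmorphN nrmZr normrN1 mul1r.
Qed.

Lemma nrmBC a b : nrm (a - b) = nrm (b - a).
Proof. by rewrite -nrmN opprB. Qed.

Lemma nrm_leB a b : nrm (a - b) <= nrm a + nrm b.
Proof. by rewrite -(nrmN b); exact: nrm_triangle cstar _ _. Qed.

Lemma nrm_dist a b : nrm a <= nrm b + nrm (a - b).
Proof. by rewrite -{1}(subrK b a) addrC; exact: nrm_triangle cstar _ _. Qed.

Lemma nrm_trans a b c : nrm (a - c) <= nrm (a - b) + nrm (b - c).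
Proof. by have := nrm_triangle cstar (a - b) (b - c); rewrite addrA subrK. Qed.

Lemma nrm_alg l : nrm l%:A = normc l.
Proof. by rewrite nrmZ (nrm_one cstar) mulr1. Qed.

Lemma nrmX a n : nrm (a ^+ n) <= nrm a ^+ n.
Proof.
elim: n => [|n IH]; first by rewrite !expr0 (nrm_one cstar).
rewrite !exprS; apply: le_trans (nrm_submult cstar _ _) _.
by apply: ler_wpM2l IH; exact: nrm_ge0 cstar _.
Qed.

Lemma nrm_small0 a : (forall e : R, 0 < e -> nrm a <= e) -> a = 0.
Proof.
move=> H; apply: (nrm_eq0 cstar); apply/eqP; rewrite eq_le (nrm_ge0 cstar) andbT.
by apply/ler_addgt0Pl => e e0; rewrite addr0 H.
Qed.

Lemma star0 : star 0 = 0.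
Proof. by have := star_add cstar 0 0; rewrite addr0 => /eqP; rewrite -subr_eq subrr => /eqP. Qed.

Lemma starN a : star (- a) = - star a.
Proof. by apply/eqP; rewrite -subr_eq0 opprK -(star_add cstar) addNr star0. Qed.

Lemma starB a b : star (a - b) = star a - star b.
Proof. by rewrite (star_add cstar) starN. Qed.

Lemma star1 : star 1 = 1.
Proof.
by rewrite -{2}(star_invol cstar 1) -{2}(mulr1 (star 1)) (star_mul cstar) (star_invol cstar) mulr1.
Qed.

Lemma star_alg l : star l%:A = (conjc l)%:A.
Proof. by rewrite (star_scale cstar) star1. Qed.

Lemma star_real (r : R) a : star (r%:C *: a) = r%:C *: star a.
Proof. by rewrite (star_scale cstar) conjc_real. Qed.

Lemma nrm_star a : nrm (star a) = nrm a.
Proof.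
suff H b : nrm b <= nrm (star b).
  by apply/eqP; rewrite eq_le H -{2}(star_invol cstar a) H.
have [->|b0] := eqVneq (nrm b) 0; first exact: nrm_ge0 cstar _.
have bp : 0 < nrm b by rewrite lt_neqAle eq_sym b0 (nrm_ge0 cstar).
by rewrite -(ler_pM2r bp) -expr2 -(cstar_identity cstar) (nrm_submult cstar).
Qed.

(** By the C*-identity, squaring a selfadjoint element squares its norm. Dyadic powers thus play the
    role of the spectral radius formula. *)
Lemma selfadjoint_nrmX a n :
  selfadjoint star a -> nrm (a ^+ (2 ^ n)) = nrm a ^+ (2 ^ n).
Proof.
move=> sa; have saX m : selfadjoint star (a ^+ m).
  elim: m => [|m IH]; first exact: star1.
  by rewrite /selfadjoint exprS (star_mul cstar) IH sa -exprSr exprS.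
elim: n => [//|n IH]; rewrite expnSr !exprM -IH -(cstar_identity cstar).
by rewrite saX.
Qed.

Lemma invertibleM a b : invertible a -> invertible b -> invertible (a * b).
Proof.
move=> [a' [aa' a'a]] [b' [bb' b'b]]; exists (b' * a'); split.
  by rewrite mulrA -(mulrA a) bb' mulr1.
by rewrite mulrA -(mulrA b') a'a mulr1.
Qed.

Lemma invertible_alg l : l != 0 -> invertible (l%:A : A).
Proof.
by move=> l0; exists (l^-1)%:A; rewrite -!scalerAl !mul1r !scalerA mulfV// mulVf// scale1r.
Qed.

Lemma expr_small (r e : R) : 0 <= r < 1 -> 0 < e -> exists N, forall n, (N <= n)%N -> r ^+ n < e.
Proof.
move=> /andP[r0 r1] e0.
have /cvg_expr/cvgrPdist_lt/(_ e e0) : `|r| < 1 by rewrite ger0_norm.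
move=> -[N _ HN]; exists N => n Nn; have := HN n Nn.
by rewrite sub0r normrN ger0_norm// exprn_ge0.
Qed.

Lemma neumann a : nrm a < 1 ->
  exists2 b, inverse_of (1 - a) b & nrm b <= (1 - nrm a)^-1.
Proof.
set r := nrm a => r1; have r0 : 0 <= r := nrm_ge0 cstar a.
have r1' : 0 < 1 - r by rewrite subr_gt0.
pose u n := \sum_(i < n) a ^+ i.
(* The tail of the geometric series, in a closed form that suits induction on [m]. *)
have uB n m : nrm (u (n + m)%N - u n) <= (r ^+ n - r ^+ (n + m)) / (1 - r).
  elim: m => [|m IH]; first by rewrite addn0 !subrr nrm0 mul0r.
  rewrite addnS /u big_ord_recr/= -/(u _) addrAC.
  apply: le_trans (nrm_triangle cstar _ _) _.
  apply: le_trans (lerD IH (nrmX _ _)) _.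
  rewrite ler_pdivlMr// mulrDl divfK ?gt_eqF// exprS -/r; lra.
have telE n : (1 - a) * u n = 1 - a ^+ n /\ u n * (1 - a) = 1 - a ^+ n.
  have comm : GRing.comm (1 - a) (u n).
    apply: commr_sum => i _; apply: commrX; apply: commr_sym.
    by apply: commrB; [exact: commr1|].
  suff E : (1 - a) * u n = 1 - a ^+ n by rewrite -comm E.
  by apply/eqP; rewrite -eqr_opp -mulNr !opprB -subrX1.
have r01 : 0 <= r < 1 by rewrite r0.
have [l lP] : exists l : A, forall e : R, 0 < e -> exists N, forall n, (N <= n)%N -> nrm (u n - l) < e.
  apply: (nrm_complete cstar) => e e0.
  have [N HN] := expr_small _ _ r01 (mulr_gt0 e0 r1').
  suff H n m : (N <= n)%N -> (n <= m)%N -> nrm (u m - u n) < e.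
    exists N => n m Nn Nm; case/orP: (leq_total n m) => nm; last exact: H.
    by rewrite nrmBC; exact: H.
  move=> Nn /subnKC <-; apply: le_lt_trans (uB _ _) _.
  rewrite ltr_pdivrMr//; apply: le_lt_trans (HN n Nn).
  by rewrite gerBl exprn_ge0.
have lim e : 0 < e -> exists n, nrm (l - u n) <= e /\ nrm (a ^+ n) <= e.
  move=> e0; have [N HN] := expr_small _ _ r01 e0; have [M HM] := lP e e0.
  exists (maxn N M); rewrite nrmBC (ltW (HM _ (leq_maxr _ _))); split=> //.
  exact: le_trans (nrmX _ _) (ltW (HN _ (leq_maxl _ _))).
have n1a : nrm (1 - a) <= 2.
  by apply: le_trans (nrm_leB _ _) _; rewrite (nrm_one cstar) -/r; lra.
(* Replacing [l] by [u n] leaves [a ^+ n] and a product of [1 - a] with [l - u n]. Since [1 - a] has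
   norm at most 2, bounds of e/3 on [a ^+ n] and [l - u n] give a total error of at most e. *)
have inv1 : inverse_of (1 - a) l.
  split; apply/eqP; rewrite -subr_eq0; apply/eqP; apply: nrm_small0 => e e0;
    (have [n [ln an]] : exists n, nrm (l - u n) <= e / 3 /\ nrm (a ^+ n) <= e / 3
       by apply: lim; lra); have [E1 E2] := telE n.
  - rewrite -[X in X - 1](subrK ((1 - a) * u n)) -mulrBr E1 -addrA [1 - _ - 1]addrAC subrr sub0r.
    apply: le_trans (nrm_leB _ _) _; have := nrm_submult cstar (1 - a) (l - u n).
    have := ler_pM (nrm_ge0 cstar _) (nrm_ge0 cstar _) n1a ln; lra.
  - rewrite -[X in X - 1](subrK (u n * (1 - a))) -mulrBl E2 -addrA [1 - _ - 1]addrAC subrr sub0r.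
    apply: le_trans (nrm_leB _ _) _; have := nrm_submult cstar (l - u n) (1 - a).
    have := ler_pM (nrm_ge0 cstar _) (nrm_ge0 cstar _) ln n1a; lra.
(* From l = 1 + a l follows nrm l <= 1 + r * nrm l, which is the bound. *)
exists l => //; rewrite -div1r ler_pdivlMr// mulrBr mulr1.
have [E _] := inv1; rewrite mulrBl mul1r in E.
have : nrm l <= nrm 1 + nrm (a * l) by have := nrm_dist l 1; rewrite -{2}E opprB addrCA subrr addr0.
rewrite (nrm_one cstar); have := nrm_submult cstar a l; rewrite -/r (mulrC _ r); lra.
Qed.

(** One has a' = a (1 - b (a - a')), and the second factor is within 1/2 of 1, so its Neumann
    inverse has norm at most 2. The explicit [K] makes resolvent bounds locally uniform. *)
Lemma inverse_perturb a b a' (K : R) : inverse_of a b -> nrm b <= K ->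
  K * nrm (a' - a) <= 2^-1 ->
  exists2 b', inverse_of a' b' & nrm b' <= 2 * K.
Proof.
move=> [ab ba] bK HK; have n0 := nrm_ge0 cstar.
have small : nrm (b * (a - a')) <= 2^-1.
  apply: le_trans (nrm_submult cstar _ _) _; rewrite nrmBC.
  by apply: le_trans HK; rewrite ler_wpM2r.
have [|c [c1 c2] cK] := neumann (b * (a - a')); first lra.
have E : a * (1 - b * (a - a')) = a' by rewrite mulrBr mulr1 mulrA ab mul1r subKr.
exists (c * b); first split.
- by rewrite -E -mulrA (mulrA _ c) c1 mul1r.
- by rewrite -E -mulrA (mulrA b) ba mul1r.
apply: le_trans (nrm_submult cstar _ _) _; apply: ler_pM => //.
apply: le_trans cK _; rewrite invf_ple ?posrE; lra.
Qed.

Lemma notin_spectrum a l : ~ spectrum a l -> exists b, inverse_of (a - l%:A) b.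
Proof. by move=> /contrapT. Qed.

Lemma spectrum_bound a l : spectrum a l -> normc l <= nrm a.
Proof.
move=> sl; rewrite leNgt; apply/negP => lt; apply: sl.
have l0 : l != 0.
  by apply: contraTneq lt => ->; rewrite ComplexField.Normc.normc0 -leNgt (nrm_ge0 cstar).
have nl : normc l != 0.
  by apply: contra l0 => /eqP/ComplexField.Normc.eq0_normc/eqP.
have np : 0 < normc l by rewrite lt_neqAle eq_sym nl normc_ge0.
have [|b [b1 b2] _] := neumann (l^-1 *: a).
  by rewrite nrmZ ComplexField.Normc.normcV mulrC ltr_pdivrMr ?mul1r.
suff -> : a - l%:A = (- l)%:A * (1 - l^-1 *: a).
  by apply: invertibleM; [apply: invertible_alg; rewrite oppr_eq0|exists b].
by rewrite -scalerAl mul1r scalerBr scalerA mulNr mulfV// !scaleNr scale1r opprK addrC.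
Qed.

Lemma spectrum_shift a l (z : R[i]) : spectrum a l -> spectrum (a - z%:A) (l - z).
Proof. by rewrite /spectrum/= scalerBl opprB addrA subrK. Qed.

Lemma spectrum_dist a l (z : R[i]) : spectrum a l -> normc (l - z) <= nrm (a - z%:A).
Proof. by move=> /(spectrum_shift _ _ z)/spectrum_bound. Qed.

(** The cross terms cancel: with s = a + it, star s * s = a^2 + t^2. The bound grows only like t^2,
    which is what forces the spectrum to be real. *)
Lemma nrm_shift_imag a (t : R) : selfadjoint star a ->
  nrm (a + (Complex 0 t)%:A) ^+ 2 <= nrm a ^+ 2 + t ^+ 2.
Proof.
move=> sa; rewrite -(cstar_identity cstar) (star_add cstar) sa star_alg.
have -> : (a + (conjc (Complex 0 t))%:A) * (a + (Complex 0 t)%:A) = a ^+ 2 + (t ^+ 2)%:C%:A.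
  rewrite mulrDl !mulrDr -!scalerAr -!scalerAl !mulr1 mul1r scalerA -expr2 -!addrA.
  congr (_ + _); rewrite addrA -scalerDl.
  have -> : Complex 0 t + conjc (Complex 0 t) = 0 by apply/eqP; rewrite eq_complex/= addr0 subrr !eqxx.
  rewrite scale0r add0r; congr (_ *: _); apply/eqP.
  by rewrite eq_complex /=; apply/andP; split; apply/eqP; ring.
apply: le_trans (nrm_triangle cstar _ _) _; rewrite nrm_alg normc_real ger0_norm ?sqr_ge0//.
by rewrite lerD2r nrmX.
Qed.

Lemma normc_sqr l : normc l ^+ 2 = complex.Re l ^+ 2 + complex.Im l ^+ 2.
Proof. by case: l => x y /=; rewrite sqr_sqrtr// addr_ge0 ?sqr_ge0. Qed.

Lemma selfadjoint_spectrum_real a l : selfadjoint star a -> spectrum a l ->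
  complex.Im l = 0.
Proof.
case: l => x y sa /= sl; apply/eqP; apply: contraPT isT => y0 _.
(* For l = x + iy, the shift bound reads x^2 + (y + t)^2 <= nrm a ^ 2 + t^2. This [t] makes 2yt =
   nrm a ^ 2 + 1, which leaves x^2 + y^2 <= -1. *)
pose t : R := (nrm a ^+ 2 + 1) / (2 * y).
have := spectrum_dist _ _ (- Complex 0 t) sl.
rewrite scaleNr !opprK -(ler_pXn2r (ltn0Sn 1)) ?nnegrE ?normc_ge0 ?(nrm_ge0 cstar)//.
move=> /le_trans/(_ (nrm_shift_imag _ t sa)); rewrite normc_sqr/= addr0.
have -> : nrm a ^+ 2 = 2 * y * t - 1 by rewrite /t mulrC divfK ?addrK// mulf_neq0 ?pnatr_eq0.
have := sqr_ge0 x; have := sqr_ge0 y; rewrite !expr2; nra.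
Qed.

Lemma normc_le (x y : R) : normc (Complex x y) <= `|x| + `|y|.
Proof.
rewrite -(ler_pXn2r (ltn0Sn 1)) ?nnegrE ?normc_ge0 ?addr_ge0// normc_sqr/=.
by rewrite sqrrD !real_normK ?num_real// lerD2r lerDl mulrn_wge0 // mulr_ge0.
Qed.

Lemma normc_triangle l (z : R[i]) : normc (l + z) <= normc l + normc z.
Proof. exact: le_normcD. Qed.

Lemma normcN l : normc (- l) = normc l.
Proof. exact: normcN. Qed.

Lemma subrBB (V : zmodType) (t x y : V) : (t - x) - (t - y) = y - x.
Proof. by rewrite opprB addrC addrA subrK. Qed.

(** * Compactness in the complex plane and the spectral radius of selfadjoint elements *)

Lemma square_ind (r : R) (P : set R[i] -> Prop) :
  P set0 -> (forall S S', S `<=` S' -> P S' -> P S) ->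
  (forall S S', P S -> P S' -> P (S `|` S')) ->
  (forall z, exists2 e, 0 < e & P [set w | normc (w - z) < e]) ->
  P [set z | `|complex.Re z| <= r /\ `|complex.Im z| <= r].
Proof.
move=> P0 Psub PU Ploc.
have cS : compact (`[- r, r]%classic `*` `[- r, r]%classic : set (R * R)).
  by apply: compact_setX; exact: segment_compact.
pose P' S := P [set z | S (complex.Re z, complex.Im z)].
suff : P' (`[- r, r]%classic `*` `[- r, r]%classic : set (R * R)).
  by apply: Psub => -[x y] /= [xr yr]; rewrite !in_itv/= -!ler_norml.
apply: compact_ind cS _ _ _ _ => //; rewrite /P'.
- by move=> S S' SS'; apply: Psub => z; exact: SS'.
- by move=> S S' PS PS'; exact: PU.
move=> [x y] _; have [e e0 Pe] := Ploc (Complex x y).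
exists [set w : R * R | normc (Complex w.1 w.2 - Complex x y) < e].
  have e20 : 0 < e / 2 by lra.
  exists (ball x (e / 2), ball y (e / 2)).
    by split; exact: nbhsx_ballx.
  move=> [y1 y2] [] /=; rewrite /ball/= => h1 h2.
  apply: le_lt_trans (normc_le _ _) _.
  rewrite distrC [X in _ + X]distrC; lra.
by apply: Psub Pe => -[].
Qed.

(** Perturbation bounds the inverses near each point of the disc; compactness of a square containing
    the disc makes the bound global. *)
Lemma resolvent_bounded (k : A) :
  (forall z, normc z <= 1 -> exists b, inverse_of (1 - z *: k) b) ->
  exists2 K, 0 <= K &
    forall z, normc z <= 1 -> exists2 b, inverse_of (1 - z *: k) b & nrm b <= K.
Proof.
move=> Hk.
pose P S := exists2 K, 0 <= K &
  forall z, S z -> normc z <= 1 -> exists2 b, inverse_of (1 - z *: k) b & nrm b <= K.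
have [K K0 HK] : P [set z | `|complex.Re z| <= 1 /\ `|complex.Im z| <= 1].
  apply: square_ind.
  - by exists 0.
  - by move=> S S' SS' [K K0 HK]; exists K => // z /SS'; exact: HK.
  - move=> S S' [K K0 HK] [K' K'0 HK']; exists (K + K'); first exact: addr_ge0.
    move=> z [Sz|Sz] z1; [have [b bP bK] := HK z Sz z1|have [b bP bK] := HK' z Sz z1].
      by exists b => //; lra.
    by exists b => //; lra.
  move=> z; have [z1|z1] := leP (normc z) 1; last first.
    (* This ball misses the closed disc, so the requirement is vacuous on it. *)
    exists (normc z - 1); first lra.
    exists 0 => // w /= wz w1; exfalso.
    have := normc_triangle w (z - w); rewrite addrC subrK -(normcN (z - w)) opprB; lra.
  have [b bP] := Hk z z1; have n0 := nrm_ge0 cstar.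
  (* Moving z by at most 1/(2K) moves 1 - z k by at most 1/(2 (1 + nrm b)), as [inverse_perturb]
     requires; the added ones keep [K] positive. *)
  pose K := (1 + nrm b) * (1 + nrm k); have K0 : 0 < K by apply: mulr_gt0; rewrite ltr_pwDl.
  exists (2 * K)^-1; first by rewrite invr_gt0; lra.
  exists (2 * (1 + nrm b)); first by have := n0 b; lra.
  move=> w /= wz _; apply: inverse_perturb bP _ _; first by rewrite lerDr.
  rewrite subrBB -scalerBl nrmZ -normcN opprB.
  have {wz} : normc (w - z) * (2 * K) <= 1.
    have K2 : 0 < 2 * K by lra.
    by move/ltW: wz; rewrite -(ler_pM2r K2) mulVf ?gt_eqF.
  have : (1 + nrm b) * (normc (w - z) * nrm k) <= normc (w - z) * K.
    rewrite /K mulrCA ler_wpM2l ?normc_ge0// ler_wpM2l ?addr_ge0//; lra.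
  by have := n0 k; lra.
exists K => // z z1; apply: HK => //=.
have := normc_sqr z; have := normc_ge0 z.
case: z z1 => x y /=; set s := Num.sqrt _ => s1 s0 sE.
by split; rewrite -(ler_pXn2r (ltn0Sn 1)) ?nnegrE// real_normK ?num_real//; nra.
Qed.

(* The dyadic form of averaging the resolvent over the roots of unity: it passes
   from k to k^2 without degrading the constant L. *)
Lemma resolvent_squaring (k : A) (L r : R) n :
  (forall w, normc w = 1 -> exists b b',
     [/\ inverse_of (1 - w *: k) b, inverse_of (1 - (r%:C * w) *: k) b' & nrm (b - b') <= L]) ->
  forall w, normc w = 1 -> exists b b',
     [/\ inverse_of (1 - w *: k ^+ (2 ^ n)) b,
         inverse_of (1 - ((r ^+ (2 ^ n))%:C * w) *: k ^+ (2 ^ n)) b' & nrm (b - b') <= L].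
Proof.
move=> base; elim: n => [//|n IH] w w1.
have sqr_norm1 l : normc l ^+ 2 = 1 -> normc l = 1.
  by move/eqP; rewrite sqrf_eq1 => /orP[/eqP//|/eqP E]; have := normc_ge0 l; rewrite E; lra.
have v1 : normc (sqrtc w) = 1.
  by apply: sqr_norm1; rewrite expr2 -ComplexField.Normc.normcM -expr2 sqr_sqrtc.
set v := sqrtc w in v1; have vv : v * v = w by rewrite -expr2 sqr_sqrtc.
have v1' : normc (- v) = 1 by rewrite normcN.
set m := (2 ^ n)%N in IH *; set h := k ^+ m in IH.
(* Partial fractions: 1/(1 - x^2) is the mean of 1/(1 - x) and 1/(1 + x). They are applied to the
   two square roots [v] and [- v] of [w]. *)
have half_avg (x b1 b2 : A) : inverse_of (1 - x) b1 -> inverse_of (1 + x) b2 ->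
    inverse_of (1 - x * x) ((2^-1)%:C *: (b1 + b2)).
  move=> [p1 p2] [q1 q2].
  have E1 : 1 - x * x = (1 + x) * (1 - x) by rewrite mulrDl !mulrDr !mulr1 !mul1r mulrN addrA subrK.
  have E2 : 1 - x * x = (1 - x) * (1 + x) by rewrite mulrDl !mulrDr !mulr1 !mul1r mulNr addrA addrK.
  have half : (2^-1)%:C *: (1 + 1 : A) = 1.
    rewrite scalerDr -scalerDl -rmorphD (_ : 2^-1 + 2^-1 = 1 :> R); last by lra.
    by rewrite rmorph1 scale1r.
  have S : (1 + x) + (1 - x) = 1 + 1 by rewrite addrACA subrr addr0.
  split.
    by rewrite -scalerAr mulrDr {1}E1 E2 -!mulrA p1 q1 !mulr1 S.
  by rewrite -scalerAl mulrDl {1}E2 E1 !mulrA p2 q2 !mul1r S.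
have [b1 [b1' [i1 i1' d1]]] := IH v v1; have [b2 [b2' [i2 i2' d2]]] := IH (- v) v1'.
exists ((2^-1)%:C *: (b1 + b2)), ((2^-1)%:C *: (b1' + b2')).
have hE : k ^+ (2 ^ n.+1) = h * h by rewrite expnSr exprM.
have rE : r ^+ (2 ^ n.+1) = r ^+ m * r ^+ m by rewrite expnSr exprM.
rewrite hE rE; split.
- rewrite -vv -scalerA (_ : v *: (v *: (h * h)) = (v *: h) * (v *: h)); last first.
    by rewrite -scalerAl -scalerAr.
  by apply: half_avg => //; rewrite -[X in 1 + X]opprK -scaleNr.
- set s : R := r ^+ m in i1' i2' *.
  rewrite (_ : _ *: (h * h) = ((s%:C * v) *: h) * ((s%:C * v) *: h)); last first.
    by rewrite -scalerAl -scalerAr scalerA -vv rmorphM; congr (_ *: _); ring.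
  by apply: half_avg => //; rewrite -[X in 1 + X]opprK -scaleNr -mulrN.
- rewrite -scalerBr nrmZr ger0_norm; last by rewrite invr_ge0.
  rewrite opprD addrACA; have := nrm_triangle cstar (b1 - b1') (b2 - b2'); lra.
Qed.

(** The resolvents on the circles of radius 1 and r < 1 differ by at most 1/8, and this survives
    repeated squaring. Meanwhile the inner radius tends to 0, so the inner resolvent is close to 1;
    hence so is the outer one, which forces the power of k to be small. *)
Lemma pow_small (k : A) : nrm k <= 1 ->
  (forall z, normc z <= 1 -> exists b, inverse_of (1 - z *: k) b) ->
  exists n, nrm (k ^+ (2 ^ n)) < 1.
Proof.
move=> k1 Hk; have [K K0 HK] := resolvent_bounded _ Hk; have n0 := nrm_ge0 cstar.
(* By the resolvent identity b - b' = q b (w k) b', whose norm is at most q K^2 <= 1/8. *)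
pose q := (8 * (K * K + 1))^-1; have KK : 0 <= K * K := mulr_ge0 K0 K0.
have q0 : 0 < q by rewrite invr_gt0; lra.
have qE : q * (8 * (K * K + 1)) = 1 by rewrite mulVf// gt_eqF//; lra.
have q1 : q <= 8^-1 by nra.
pose r := 1 - q; have r01 : 0 <= r < 1 by rewrite /r; lra.
have base w : normc w = 1 -> exists b b',
    [/\ inverse_of (1 - w *: k) b, inverse_of (1 - (r%:C * w) *: k) b' & nrm (b - b') <= 8^-1].
  move=> w1; have [|b bP bK] := HK w; first by rewrite w1.
  have [|b' bP' bK'] := HK (r%:C * w).
    by rewrite ComplexField.Normc.normcM normc_real w1 mulr1 ger0_norm//; lra.
  exists b, b'; split=> //.
  have -> : b - b' = q%:C *: (b * (w *: k) * b').
    have -> : b - b' = b * (1 - (r%:C * w) *: k) * b' - b * (1 - w *: k) * b'.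
      by rewrite -(mulrA b) (proj1 bP') mulr1 (proj2 bP) mul1r.
    rewrite -mulrBl -mulrBr.
    rewrite scalerAl scalerAr; congr (_ * _ * _).
    by rewrite subrBB -scalerBl scalerA; congr (_ *: _); rewrite /r rmorphB rmorph1; ring.
  rewrite nrmZr ger0_norm ?ltW//.
  have : nrm (b * (w *: k) * b') <= K * K.
    apply: le_trans (nrm_submult cstar _ _) _; apply: ler_pM => //.
    apply: le_trans (nrm_submult cstar _ _) _; rewrite nrmZ w1 mul1r.
    by rewrite -(mulr1 K); apply: ler_pM.
  by move=> H; nra.
have [N HN] := expr_small _ 8^-1 r01 ltac:(lra).
exists N; set h := k ^+ _.
have h1 : nrm h <= 1.
  by apply: le_trans (nrmX _ _) _; rewrite exprn_ile1.
have [|b [b' [bP bP' bb']]] := resolvent_squaring _ _ _ N base 1.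
  exact: ComplexField.Normc.normc1.
rewrite -/h scale1r mulr1 in bP bP'.
set s := r ^+ _ in bP'; have s0 : 0 <= s by rewrite exprn_ge0//; lra.
have s8 : s < 8^-1 by apply: HN; exact: ltnW (ltn_expl _ _).
have b'E : b' - 1 = s%:C *: h * b'.
  by have [E _] := bP'; rewrite mulrBl mul1r in E; rewrite -E opprB addrCA subrr addr0.
have shs : nrm (s%:C *: h) <= 8^-1 by rewrite nrmZr ger0_norm//; have := n0 h; nra.
(* Since b' - 1 = s h b' and nrm (s h) <= 1/8, nrm (b' - 1) is at most 1/7, hence nrm (b - 1) <=
   1/3. Then h = (b - 1)(1 - h) gives nrm h <= 1/2. *)
have b'1 : nrm (b' - 1) <= 8^-1 * (1 + nrm (b' - 1)).
  rewrite {1}b'E; apply: le_trans (nrm_submult cstar _ _) _; apply: ler_pM => //.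
  by have := nrm_dist b' 1; rewrite (nrm_one cstar).
have b1 : nrm (b - 1) <= 3^-1 by have := nrm_trans b b' 1; lra.
have hE : h = (b - 1) * (1 - h) by rewrite mulrBl (proj2 bP) mul1r opprB addrC subrK.
have : nrm h <= 3^-1 * (1 + nrm h).
  rewrite {1}hE; apply: le_trans (nrm_submult cstar _ _) _; apply: ler_pM => //.
  by have := nrm_leB 1 h; rewrite (nrm_one cstar).
lra.
Qed.

(** Otherwise 1 - z k is invertible on the whole closed disc for k = a / nrm a, and [pow_small]
    contradicts the fact that dyadic powers of k have norm 1. *)
Lemma selfadjoint_nrm_spectrum a : selfadjoint star a ->
  spectrum a (nrm a)%:C \/ spectrum a (- nrm a)%:C.
Proof.
move=> sa; apply: contrapT => /not_orP[/notin_spectrum[b1 i1] /notin_spectrum[b2 i2]].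
have n0 := nrm_ge0 cstar.
have [a0|a0] := eqVneq (nrm a) 0.
  have aE := nrm_eq0 cstar a0; move: i1; rewrite a0 rmorph0 scale0r subr0 aE => -[E _].
  have := nrm_one cstar; rewrite -E mul0r nrm0; lra.
pose t := (nrm a)^-1; have t0 : 0 < t by rewrite invr_gt0 lt_neqAle eq_sym a0 n0.
pose k := t%:C *: a.
have nk : nrm k = 1 by rewrite nrmZr gtr0_norm// mulVf.
have sk : selfadjoint star k by rewrite /selfadjoint star_real sa.
have [||n] := pow_small k; last by rewrite selfadjoint_nrmX// nk expr1n ltxx.
  by rewrite nk.
move=> z z1.
have [->|z0] := eqVneq z 0.
  by exists 1; rewrite scale0r subr0; split; rewrite mulr1.
(* 1 - z k is a nonzero multiple of a - nrm a / z. The point nrm a / z has modulus at least nrm a;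
   being in the spectrum, it would be real of modulus exactly nrm a, that is, one of the two
   excluded points. *)
suff [b [bl br]] : exists b, inverse_of (a - ((nrm a)%:C / z)%:A) b.
  have zt : z * t%:C != 0 by rewrite mulf_neq0// fmorph_eq0 gt_eqF.
  have tE : t%:C * (nrm a)%:C = 1 by rewrite -rmorphM mulVf// rmorph1.
  have E : 1 - z *: k = (- (z * t%:C)) *: (a - ((nrm a)%:C / z)%:A).
    rewrite scalerBr !scalerA mulNr !scaleNr opprK [RHS]addrC; congr (_ - _).
    by rewrite [z * _]mulrC mulrACA tE mul1r mulfV// scale1r.
  exists ((- (z * t%:C))^-1 *: b); rewrite E.
  by split; rewrite -scalerAl -scalerAr scalerA ?bl ?br ?mulfV ?mulVf ?oppr_eq0// scale1r.
apply: notin_spectrum => sz.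
have z0' : 0 < normc z.
  rewrite lt_neqAle normc_ge0 andbT eq_sym.
  by apply: contra z0 => /eqP/ComplexField.Normc.eq0_normc/eqP.
have := spectrum_bound _ _ sz.
have : nrm a <= normc ((nrm a)%:C / z).
  rewrite ComplexField.Normc.normcM ComplexField.Normc.normcV normc_real ger0_norm//.
  by rewrite ler_pdivlMr// ler_piMr.
have := selfadjoint_spectrum_real _ _ sa sz.
case: (_ / z) sz => x y /= sz y0; rewrite y0 in sz *; rewrite expr0n/= addr0 sqrtr_sqr.
move=> le1 le2; have : `|x| = nrm a by apply/eqP; rewrite eq_le le1 le2.
have [x0|x0] := leP 0 x; [rewrite ger0_norm//|rewrite ltr0_norm//] => xE.
  by move: sz; rewrite -/(real_complex _ _) xE; case: i1 => ? ? []; exists b1.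
by move: sz; rewrite -[x]opprK xE; case: i2 => ? ? []; exists b2.
Qed.

(** Factor p - l into linear factors over the algebraically closed field: if every a - z at a root z
    were invertible, so would be the product. A nonempty spectrum is needed when p is the constant
    l. *)
Lemma spectrum_horner (p : {poly R[i]}) a l : spectrum a !=set0 ->
  spectrum (horner_alg a p) l ->
  exists2 z, spectrum a z & p.[z] = l.
Proof.
move=> [z0 sz0] sl; pose q := p - l%:P; have [qE|q0] := eqVneq q 0.
  have pE : p = l%:P by apply/eqP; rewrite -subr_eq0 -/q qE.
  by exists z0; rewrite // pE hornerC.
have [r qE] := closed_field_poly_normal q.
apply: contrapT => H; apply: sl.
have -> : horner_alg a p - l%:A = horner_alg a q by rewrite /q rmorphB /= horner_algC.
have lq0 : lead_coef q != 0 by rewrite lead_coef_eq0.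
have rP z : z \in r -> invertible (a - z%:A).
  move=> zr; apply: contrapT => nz; apply: H; exists z => //.
  apply/eqP; rewrite -subr_eq0 -(hornerC l z) -hornerN -hornerD -/q qE hornerZ horner_prod.
  by rewrite (big_rem _ zr)/= hornerXsubC subrr mul0r mulr0.
rewrite qE linearZ/= rmorph_prod; apply: invertibleM; first exact: invertible_alg.
elim: r rP {qE} => [|z r IH] rP.
  by rewrite big_nil; exists 1; rewrite mulr1.
rewrite big_cons; apply: invertibleM.
  by rewrite rmorphB/= horner_algX horner_algC; apply: rP; rewrite mem_head.
by apply: IH => x xr; apply: rP; rewrite inE xr orbT.
Qed.

(** * Real polynomials in a selfadjoint element *)

Definition peval a (p : {poly R}) : A := horner_alg a (map_poly (real_complex R) p).

Lemma pevalC a (r : R) : peval a r%:P = r%:C%:A.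
Proof. by rewrite /peval map_polyC horner_algC. Qed.
Lemma pevalX a : peval a 'X = a.
Proof. by rewrite /peval map_polyX horner_algX. Qed.
Lemma pevalD a p q : peval a (p + q) = peval a p + peval a q.
Proof. by rewrite /peval rmorphD rmorphD. Qed.
Lemma pevalB a p q : peval a (p - q) = peval a p - peval a q.
Proof. by rewrite /peval rmorphB rmorphB. Qed.
Lemma pevalM a p q : peval a (p * q) = peval a p * peval a q.
Proof. by rewrite /peval rmorphM rmorphM. Qed.

Lemma peval_selfadjoint a p : selfadjoint star a -> selfadjoint star (peval a p).
Proof.
move=> sa; rewrite /selfadjoint; elim/poly_ind: p => [|p r IH].
  by rewrite -(polyC0) pevalC rmorph0 scale0r star0.
rewrite pevalD pevalM pevalC pevalX (star_add cstar) star_real star1 (star_mul cstar) IH sa.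
by rewrite -{1}(pevalX a) -pevalM mulrC pevalM pevalX.
Qed.

Lemma peval_comm a b p : a * b = b * a -> peval a p * b = b * peval a p.
Proof.
move=> ab; elim/poly_ind: p => [|p r IH].
  by rewrite -(polyC0) pevalC rmorph0 scale0r mul0r mulr0.
rewrite pevalD pevalM pevalC pevalX mulrDl mulrDr -mulrA ab !mulrA IH.
by rewrite -!scalerAl -scalerAr mul1r mulr1.
Qed.

(** The norm of the selfadjoint value is, up to sign, one of its spectral points, and that point is
    p at a real spectral point of a. This estimate carries the calculus from polynomials to their
    uniform limits. *)
Lemma nrm_peval a (p : {poly R}) (B : R) : selfadjoint star a ->
  (forall t : R, spectrum a t%:C -> `|p.[t]| <= B) -> nrm (peval a p) <= B.
Proof.
move=> sa HB; have sp := peval_selfadjoint _ p sa.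
have ne : spectrum a !=set0.
  by have [] := selfadjoint_nrm_spectrum _ sa; [exists (nrm a)%:C|exists (- nrm a)%:C].
have H (s : R) : `|s| = nrm (peval a p) -> spectrum (peval a p) s%:C -> nrm (peval a p) <= B.
  move=> <- /(spectrum_horner _ _ _ ne)[z sz].
  have z0 := selfadjoint_spectrum_real _ _ sa sz.
  have zE : z = (complex.Re z)%:C by case: z z0 {sz} => x y /= ->.
  by rewrite zE horner_map => /complexI <-; apply: HB; rewrite -zE.
have n0 := nrm_ge0 cstar (peval a p).
have [] := selfadjoint_nrm_spectrum _ sp; apply: H; first by rewrite ger0_norm.
by rewrite normrN ger0_norm.
Qed.

(* (AX2) enters only through this identity: it equates norms of selfadjoint values. *)
Lemma Mspec_nrm a : selfadjoint star a -> nrm a = Num.max (Mspec a) (Mspec (- a)).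
Proof.
move=> sa.
have n0 := nrm_ge0 cstar.
have sN b l : spectrum b l -> spectrum (- b) (- l).
  move=> sl [c [c1 c2]]; apply: sl; exists (- c).
  have -> : b - l%:A = - (- b - (- l)%:A) by rewrite scaleNr opprK opprD opprK.
  by rewrite !mulrNN.
have ub b : ubound [set complex.Re l | l in spectrum b] (nrm b).
  move=> _ [l /spectrum_bound le <-]; apply: le_trans le.
  case: l => x y /=; apply: le_trans (ler_norm x) _.
  by rewrite -sqrtr_sqr ler_wsqrtr// lerDl sqr_ge0.
have leM b : Mspec b <= nrm b.
  (* The empty case is harmless because the supremum of the empty set is 0 by convention. *)
  rewrite /Mspec; have [->|/set0P ne] := eqVneq [set complex.Re l | l in spectrum b] set0.
    by rewrite sup0.
  by apply: ge_sup.
have geM b : spectrum b (nrm b)%:C -> nrm b <= Mspec b.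
  move=> sb; apply: ub_le_sup; first by exists (nrm b); exact: ub.
  by exists (nrm b)%:C.
have leMN : Mspec (- a) <= nrm a by rewrite -(nrmN a).
apply/eqP; rewrite eq_le le_max ge_max leM leMN !andbT.
have [sp|sp] := selfadjoint_nrm_spectrum _ sa; first by rewrite geM.
apply/orP; right; rewrite -(nrmN a); apply: geM.
by rewrite nrmN -[nrm a]opprK rmorphN; exact: sN.
Qed.

(** * Functional calculus for selfadjoint elements *)

(** Stands for continuity on [-C, C]. Closure under sums, products, max and min covers every ramp
    and tent used later, without the general Weierstrass theorem. *)
Definition poly_approx (C : R) (f : R -> R) := forall e : R, 0 < e ->
  exists p : {poly R}, forall t, `|t| <= C -> `|p.[t] - f t| <= e.

Lemma poly_approx_horner (C : R) (p : {poly R}) : poly_approx C (horner p).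
Proof. by move=> e e0; exists p => t _; rewrite subrr normr0 ltW. Qed.

Lemma poly_approx_eq (C : R) (f g : R -> R) : f =1 g -> poly_approx C f -> poly_approx C g.
Proof. by move=> /funext->. Qed.

Lemma poly_approxD (C : R) (f g : R -> R) :
  poly_approx C f -> poly_approx C g -> poly_approx C (fun t => f t + g t).
Proof.
move=> af ag e e0; have e2 : 0 < e / 2 by lra.
have [p pP] := af _ e2; have [q qP] := ag _ e2; exists (p + q) => t tC.
rewrite hornerD opprD addrACA; apply: le_trans (ler_normD _ _) _.
by have := pP t tC; have := qP t tC; lra.
Qed.

Lemma poly_approxZ (C c : R) (f : R -> R) :
  poly_approx C f -> poly_approx C (fun t => c * f t).
Proof.
move=> af e e0; have c1 : 0 < `|c| + 1 by rewrite ltr_wpDl.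
have [|p pP] := af (e / (`|c| + 1)); first by rewrite divr_gt0.
exists (c *: p) => t /pP; rewrite hornerZ -mulrBr normrM ler_pdivlMr// => H.
by apply: le_trans H; rewrite mulrC ler_wpM2l// lerDl.
Qed.

Lemma poly_approx_cst (C c : R) : poly_approx C (fun=> c).
Proof. by apply: poly_approx_eq (poly_approx_horner C c%:P) => t; rewrite hornerC. Qed.

Lemma poly_approx_affine (C c d : R) : poly_approx C (fun t => c * t + d).
Proof.
apply: poly_approx_eq (poly_approx_horner C (c *: 'X + d%:P)) => t.
by rewrite !hornerE.
Qed.

(** The classical iteration q + (t^2 - q^2)/2 increases to |t| on [-1, 1], with error at most 2/n
    after n rounds. *)
Lemma sqrt_iter (e : R) : 0 < e -> exists p : {poly R},
  forall t, `|t| <= 1 -> `|p.[t] - `|t| | <= e.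
Proof.
move=> e0.
pose p n : {poly R} := iter n (fun q => q + 2^-1 *: ('X^2 - q ^+ 2)) 0.
have pP n t : `|t| <= 1 -> [/\ 0 <= (p n).[t], (p n).[t] <= `|t| & (`|t| - (p n).[t]) * n%:R <= 2].
  move=> t1; have t0 := normr_ge0 t; elim: n => [|n [h1 h2 h3]].
    by rewrite /= horner0 mulr0.
  have -> : (p n.+1).[t] = (p n).[t] + 2^-1 * (`|t| ^+ 2 - (p n).[t] ^+ 2).
    by rewrite /= -/(p n) !hornerE real_normK ?num_real.
  set x := (p n).[t] in h1 h2 h3 *; set s := `|t| in t0 t1 h2 h3 *.
  split; [nra|nra|].
  rewrite -(natr1 n); set m : R := n%:R in h3 *; have m0 : 0 <= m by rewrite ler0n.
  (* One round multiplies the error d by 1 - (s + x)/2, which is at most 1 - d/2 because d <= s + x;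
     this preserves the bound 2 on n d. *)
  have E : s - (x + 2^-1 * (s ^+ 2 - x ^+ 2)) = (s - x) * (1 - (s + x) / 2) by field.
  rewrite E; set d := s - x in h3 *; have d0 : 0 <= d by rewrite subr_ge0.
  have sx : d <= s + x by rewrite /d; lra.
  have h : d * (1 - (s + x) / 2) <= d * (1 - d / 2) by apply: ler_wpM2l => //; lra.
  have d1 : d <= 1 by rewrite /d; lra.
  have : 0 <= (2 - d * m) * (1 - d / 2) by apply: mulr_ge0; lra.
  have := ler_wpM2r (addr_ge0 m0 ler01) h; nra.
pose n := Num.bound (2 / e).
have nP : 2 / e < n%:R by apply: archi_boundP; rewrite divr_ge0// ltW.
exists (p n) => t t1; have [h1 h2 h3] := pP n t t1.
rewrite distrC ger0_norm ?subr_ge0//.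
have n0 : 0 < n%:R :> R by apply: lt_trans nP; rewrite divr_gt0.
rewrite -(ler_pM2r n0); apply: le_trans h3 _.
by move: nP; rewrite ltr_pdivrMr// mulrC => /ltW.
Qed.

Lemma poly_bounded (C : R) (p : {poly R}) :
  exists2 M, 0 <= M & forall t, `|t| <= C -> `|p.[t]| <= M.
Proof.
elim/poly_ind: p => [|p c [M M0 HM]].
  by exists 0 => // t _; rewrite horner0 normr0.
exists (M * `|C| + `|c|); first by rewrite addr_ge0 ?mulr_ge0.
move=> t tC; rewrite hornerMXaddC; apply: le_trans (ler_normD _ _) _.
rewrite lerD2r normrM ler_pM// ?HM//; exact: le_trans tC (ler_norm _).
Qed.

Lemma poly_approx_bounded (C : R) (f : R -> R) : poly_approx C f ->
  exists2 M, 0 <= M & forall t, `|t| <= C -> `|f t| <= M.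
Proof.
move=> af; have [p pP] := af 1 ltr01.
have [M M0 HM] := poly_bounded C p; exists (M + 1); first by rewrite addr_ge0.
move=> t tC; have := pP t tC; rewrite distrC => h.
by rewrite -[f t](subrK p.[t]); apply: le_trans (ler_normD _ _) _; have := HM t tC; lra.
Qed.

(** Yields a tolerance rather than polynomials, so that [fcalM] can shrink it further and use one
    pair p, q for both of its estimates. *)
Lemma poly_approxM_aux (C e : R) (f g : R -> R) : 0 < e ->
  poly_approx C f -> poly_approx C g ->
  exists2 d, 0 < d & forall p q : {poly R},
    (forall t, `|t| <= C -> `|p.[t] - f t| <= d) ->
    (forall t, `|t| <= C -> `|q.[t] - g t| <= d) ->
    forall t, `|t| <= C -> `|(p * q).[t] - f t * g t| <= e.
Proof.
move=> e0 /poly_approx_bounded[M M0 fM] /poly_approx_bounded[N N0 gN].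
pose L := M + N + 1; have L0 : 0 < L by rewrite /L; lra.
pose d := Num.min 1 (e / L); have d0 : 0 < d by rewrite lt_min ltr01 divr_gt0.
have d1 : d <= 1 by rewrite ge_min lexx.
have dL : d * L <= e by rewrite -ler_pdivlMr// ge_min lexx orbT.
exists d => // p q pP qP t tC; rewrite hornerM.
have -> : p.[t] * q.[t] - f t * g t =
  (p.[t] - f t) * (q.[t] - g t) + (p.[t] - f t) * g t + f t * (q.[t] - g t) by ring.
apply: le_trans (ler_normD _ _) _; rewrite normrM.
apply: le_trans (lerD (ler_normD _ _) (lexx _)) _; rewrite !normrM.
have h1 : `|p.[t] - f t| * `|q.[t] - g t| <= d * 1.
  by apply: ler_pM; rewrite ?pP//; apply: le_trans d1; exact: qP.
have h2 : `|p.[t] - f t| * `|g t| <= d * N by apply: ler_pM; rewrite ?pP ?gN.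
have h3 : `|f t| * `|q.[t] - g t| <= M * d by apply: ler_pM; rewrite ?fM ?qP.
by rewrite /L in dL; lra.
Qed.

Lemma poly_approxM (C : R) (f g : R -> R) : poly_approx C f -> poly_approx C g ->
  poly_approx C (fun t => f t * g t).
Proof.
move=> af ag e e0; have [d d0 H] := poly_approxM_aux _ _ _ _ e0 af ag.
have [p pP] := af _ d0; have [q qP] := ag _ d0.
by exists (p * q); exact: H.
Qed.

(** The polynomial for the absolute value is only good on [-1, 1], so p is divided by M + 1, which
    bounds it: p is within 1 of f, and |f| <= M. *)
Lemma poly_approx_norm (C : R) (f : R -> R) :
  poly_approx C f -> poly_approx C (fun t => `|f t|).
Proof.
move=> af e e0.
have [M M0 pM] := poly_approx_bounded _ _ af.
have Me : 0 < e / (2 * (M + 1)) by rewrite divr_gt0//; lra.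
have [q qP] := sqrt_iter _ Me.
have [|p pP] := af (Num.min 1 (e / 4)); first by rewrite lt_min; lra.
pose c := (M + 1)^-1.
exists ((M + 1) *: (q \Po (c *: p))) => t tC.
have := pP t tC; rewrite le_min => /andP[h1 h2].
have hM := pM t tC.
have hp : `|p.[t]| <= M + 1.
  by rewrite -[p.[t]](subrK (f t)); apply: le_trans (ler_normD _ _) _; lra.
rewrite hornerZ horner_comp hornerZ.
have M1 : 0 < M + 1 by lra.
have hc : `|c * p.[t]| <= 1 by rewrite normrM gtr0_norm ?invr_gt0// mulrC ler_pdivrMr ?mul1r.
have := qP _ hc; set y := q.[_]; rewrite normrM gtr0_norm ?invr_gt0// => hq.
have hq2 : `|(M + 1) * y - `|p.[t]| | <= e / 2.
  have -> : (M + 1) * y - `|p.[t]| = (M + 1) * (y - c * `|p.[t]|).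
    by rewrite mulrBr mulrA mulfV ?mul1r// gt_eqF.
  rewrite normrM gtr0_norm//; move: hq; rewrite ler_pdivlMr; lra.
have := ler_dist_dist p.[t] (f t) => hd.
rewrite -[_ - _](subrKA `|p.[t]|); apply: le_trans (ler_normD _ _) _; lra.
Qed.

Lemma poly_approx_max (C : R) (f g : R -> R) :
  poly_approx C f -> poly_approx C g -> poly_approx C (fun t => Num.max (f t) (g t)).
Proof.
move=> af ag; apply: (@poly_approx_eq _ (fun t => 2^-1 * ((f t + g t) + `|f t + (-1) * g t|))).
  move=> t; rewrite mulN1r; have [h|h] := leP (f t) (g t).
    by rewrite ler0_norm ?subr_le0//; lra.
  by rewrite ger0_norm ?subr_ge0 ?ltW//; lra.
apply: poly_approxZ; apply: poly_approxD; first exact: poly_approxD.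
by apply: poly_approx_norm; apply: poly_approxD => //; exact: poly_approxZ.
Qed.

Lemma poly_approx_min (C : R) (f g : R -> R) :
  poly_approx C f -> poly_approx C g -> poly_approx C (fun t => Num.min (f t) (g t)).
Proof.
move=> af ag; apply: (@poly_approx_eq _ (fun t => (f t + g t) + (-1) * Num.max (f t) (g t))).
  by move=> t; rewrite mulN1r; have [h|h] := leP (f t) (g t); lra.
apply: poly_approxD; first exact: poly_approxD.
by apply: poly_approxZ; exact: poly_approx_max.
Qed.


(* The continuous functional calculus on the ball of radius C, pinned down by its
   values on polynomials; it is only meaningful when poly_approx C f holds. *)
Definition fcal (C : R) (f : R -> R) a : A := xget 0 [set b |
  forall (p : {poly R}) (e : R), 0 < e ->
    (forall t, `|t| <= C -> `|p.[t] - f t| <= e) -> nrm (peval a p - b) <= e].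

Lemma spectrum_real_le a (C t : R) : nrm a <= C -> spectrum a t%:C -> `|t| <= C.
Proof. by move=> aC /spectrum_bound; rewrite normc_real => /le_trans; apply. Qed.

(** The set in [fcal] is inhabited: polynomials within 1/(n + 1) of f have Cauchy values at a by
    [nrm_peval], and any other approximating polynomial stays close to their limit. *)
Lemma fcalP (C : R) (f : R -> R) a : selfadjoint star a -> nrm a <= C -> poly_approx C f ->
  forall (p : {poly R}) (e : R), 0 < e ->
    (forall t, `|t| <= C -> `|p.[t] - f t| <= e) -> nrm (peval a p - fcal C f a) <= e.
Proof.
move=> sa aC af; rewrite /fcal; set Q := (X in xget _ X); suff /(xgetPex 0) : exists b, Q b by [].
pose d (n : nat) : R := n.+1%:R^-1.
have d0 n : 0 < d n by rewrite invr_gt0 ltr0n.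
have /choice[p pP] : forall n, exists p : {poly R}, forall t, `|t| <= C -> `|p.[t] - f t| <= d n.
  by move=> n; exact: af.
have dle n m : (n <= m)%N -> d m <= d n.
  by move=> nm; rewrite lef_pV2 ?posrE ?ltr0n// ler_nat.
have dsmall (e : R) : 0 < e -> exists N, forall n, (N <= n)%N -> d n < e.
  move=> e0; exists (Num.bound e^-1) => n Nn.
  rewrite -[e]invrK ltf_pV2 ?posrE ?invr_gt0 ?ltr0n//.
  have := archi_boundP (ltW (_ : 0 < e^-1)); rewrite invr_gt0 => /(_ e0) h.
  by apply: lt_le_trans h _; rewrite ler_nat leqW.
have close (q r : {poly R}) (e1 e2 : R) :
    (forall t, `|t| <= C -> `|q.[t] - f t| <= e1) ->
    (forall t, `|t| <= C -> `|r.[t] - f t| <= e2) -> nrm (peval a q - peval a r) <= e1 + e2.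
  move=> h1 h2; rewrite -pevalB; apply: nrm_peval => // t /(spectrum_real_le _ _ _ aC) tC.
  rewrite hornerD hornerN -[_ - _](subrKA (f t)); apply: le_trans (ler_normD _ _) _.
  by rewrite lerD ?h1// distrC h2.
have [b bP] : exists b : A, forall e : R, 0 < e -> exists N, forall n, (N <= n)%N ->
    nrm (peval a (p n) - b) < e.
  apply: (nrm_complete cstar) => e e0; have [|N HN] := dsmall (e / 2); first lra.
  exists N => n m Nn Nm; apply: le_lt_trans (close _ _ _ _ (pP n) (pP m)) _.
  by have := HN n Nn; have := HN m Nm; lra.
exists b => q e e0 qe; apply/ler_addgt0Pl => e' e'0.
have e'2 : 0 < e' / 2 by lra.
have [N HN] := dsmall _ e'2; have [M HM] := bP _ e'2.
have h1 := HN _ (leq_maxl N M); have h2 := HM _ (leq_maxr N M).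
have := close _ _ _ _ qe (pP (maxn N M)).
by have := nrm_trans (peval a q) (peval a (p (maxn N M))) b; lra.
Qed.

Section FcalTheory.
Variables (C : R) (a : A).
Hypotheses (sa : selfadjoint star a) (aC : nrm a <= C).
Let n0 : forall b, 0 <= nrm b := nrm_ge0 cstar.

Lemma fcal_eq f b : poly_approx C f ->
  (forall e : R, 0 < e -> exists p : {poly R},
     (forall t, `|t| <= C -> `|p.[t] - f t| <= e) /\ nrm (peval a p - b) <= e) ->
  fcal C f a = b.
Proof.
move=> af H; apply/eqP; rewrite -subr_eq0; apply/eqP; apply: nrm_small0 => e e0.
have e2 : 0 < e / 2 by lra.
have [p [pf pb]] := H _ e2; have := fcalP _ _ _ sa aC af _ _ e2 pf.
by rewrite nrmBC => h; have := nrm_trans (fcal C f a) (peval a p) b; lra.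
Qed.

Lemma fcal_nrm f (B : R) : poly_approx C f ->
  (forall t : R, spectrum a t%:C -> `|f t| <= B) -> nrm (fcal C f a) <= B.
Proof.
move=> af fB; apply/ler_addgt0Pl => e e0; have e2 : 0 < e / 2 by lra.
have [p pP] := af _ e2.
have : nrm (peval a p) <= B + e / 2.
  apply: nrm_peval => // t st; have := fB t st; have := pP t (spectrum_real_le _ _ _ aC st).
  by move=> h1 h2; rewrite -[p.[t]](subrK (f t)); apply: le_trans (ler_normD _ _) _; lra.
have := fcalP _ _ _ sa aC af _ _ e2 pP; rewrite nrmBC.
by have := nrm_dist (fcal C f a) (peval a p); lra.
Qed.

Lemma fcalD f g : poly_approx C f -> poly_approx C g ->
  fcal C (fun t => f t + g t) a = fcal C f a + fcal C g a.
Proof.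
move=> af ag; apply: fcal_eq; first exact: poly_approxD.
move=> e e0; have e2 : 0 < e / 2 by lra.
have [p pP] := af _ e2; have [q qP] := ag _ e2; exists (p + q); split.
  move=> t tC; rewrite hornerD opprD addrACA; apply: le_trans (ler_normD _ _) _.
  by have := pP t tC; have := qP t tC; lra.
rewrite pevalD opprD addrACA; apply: le_trans (nrm_triangle cstar _ _) _.
have := fcalP _ _ _ sa aC af _ _ e2 pP; have := fcalP _ _ _ sa aC ag _ _ e2 qP; lra.
Qed.

Lemma fcal_horner (p : {poly R}) : fcal C (horner p) a = peval a p.
Proof.
apply: fcal_eq; first exact: poly_approx_horner.
by move=> e e0; exists p; split; [move=> t _; rewrite subrr normr0 ltW|rewrite subrr nrm0 ltW].
Qed.

Lemma fcal_comm f b : poly_approx C f -> a * b = b * a -> fcal C f a * b = b * fcal C f a.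
Proof.
move=> af ab; apply/eqP; rewrite -subr_eq0; apply/eqP; apply: nrm_small0 => e e0.
have b1 : 0 < nrm b + 1 by have := n0 b; lra.
have e2 : 0 < e / (2 * (nrm b + 1)) by rewrite divr_gt0// mulr_gt0.
have [p pP] := af _ e2.
have := fcalP _ _ _ sa aC af _ _ e2 pP; set c := fcal C f a; set d := peval a p.
rewrite nrmBC ler_pdivlMr ?mulr_gt0// => h.
have -> : c * b - b * c = (c - d) * b - b * (c - d).
  have db : d * b = b * d := peval_comm _ _ p ab.
  by rewrite mulrBl mulrBr db opprB addrA subrK.
apply: le_trans (nrm_leB _ _) _.
have := nrm_submult cstar (c - d) b; have := nrm_submult cstar b (c - d).
have := n0 (c - d); nra.
Qed.

Lemma fcalM f g : poly_approx C f -> poly_approx C g ->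
  fcal C (fun t => f t * g t) a = fcal C f a * fcal C g a.
Proof.
move=> af ag; apply: fcal_eq; first exact: poly_approxM.
move=> e e0.
have [M M0 fM] := poly_approx_bounded _ _ af; have [N N0 gN] := poly_approx_bounded _ _ ag.
have nf : nrm (fcal C f a) <= M by apply: fcal_nrm => // t /(spectrum_real_le _ _ _ aC)/fM.
have ng : nrm (fcal C g a) <= N by apply: fcal_nrm => // t /(spectrum_real_le _ _ _ aC)/gN.
pose L := M + N + 1; have L0 : 0 < L by rewrite /L; lra.
have [d2 d20 d2P] := poly_approxM_aux _ _ _ _ e0 af ag.
pose d := Num.min d2 (Num.min 1 (e / L)).
have d0 : 0 < d by rewrite !lt_min d20 ltr01 divr_gt0.
have dd2 : d <= d2 by rewrite ge_min lexx.
have d1 : d <= 1 by rewrite !ge_min lexx orbT.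
have dL : d * L <= e by rewrite -ler_pdivlMr// !ge_min lexx !orbT.
have [p pP] := af _ d0; have [q qP] := ag _ d0; exists (p * q); split.
  by apply: d2P => t tC; [apply: le_trans (pP t tC) _|apply: le_trans (qP t tC) _].
have := fcalP _ _ _ sa aC af _ _ d0 pP; have := fcalP _ _ _ sa aC ag _ _ d0 qP.
rewrite pevalM; set P := peval a p; set Q := peval a q; set F := fcal C f a; set G := fcal C g a.
move=> hQ hP.
have -> : P * Q - F * G = (P - F) * (Q - G) + (P - F) * G + F * (Q - G).
  by rewrite -mulrDr subrK mulrBl mulrBr addrA subrK.
apply: le_trans (nrm_triangle cstar _ _) _.
apply: le_trans (lerD (nrm_triangle cstar _ _) (lexx _)) _.
have h1 : nrm ((P - F) * (Q - G)) <= d * 1.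
  by apply: le_trans (nrm_submult cstar _ _) _; apply: ler_pM => //; apply: le_trans d1.
have h2 : nrm ((P - F) * G) <= d * N.
  by apply: le_trans (nrm_submult cstar _ _) _; apply: ler_pM.
have h3 : nrm (F * (Q - G)) <= M * d.
  by apply: le_trans (nrm_submult cstar _ _) _; apply: ler_pM.
by rewrite /L in dL; lra.
Qed.

Lemma fcal_ext f g : poly_approx C f -> poly_approx C g ->
  (forall t, `|t| <= C -> f t = g t) -> fcal C f a = fcal C g a.
Proof.
move=> af ag fg; apply: fcal_eq => // e e0; have [p pP] := ag _ e0; exists p.
by split; [move=> t tC; rewrite fg ?pP|exact: fcalP].
Qed.

Lemma fcal_sum (I : Type) (s : seq I) (f : I -> R -> R) : (forall i, poly_approx C (f i)) ->
  poly_approx C (fun t => \sum_(i <- s) f i t) /\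
  fcal C (fun t => \sum_(i <- s) f i t) a = \sum_(i <- s) fcal C (f i) a.
Proof.
move=> af; elim: s => [|i s [IH1 IH2]].
  have E : (fun t => \sum_(i <- [::]) f i t) = horner (0 : {poly R}).
    by apply/funext => t; rewrite big_nil horner0.
  rewrite E big_nil fcal_horner; split; first exact: poly_approx_horner.
  by rewrite -polyC0 pevalC rmorph0 scale0r.
have E : (fun t => \sum_(j <- i :: s) f j t) = (fun t => f i t + \sum_(j <- s) f j t).
  by apply/funext => t; rewrite big_cons.
by rewrite E big_cons fcalD// IH2; split=> //; exact: poly_approxD.
Qed.

(** On the support of f, t - x equals its truncation to [-e, e]; g is the calculus of that
    truncation. Thus a acts on f(a) as the scalar x up to e. *)
Lemma fcal_localize f (x e : R) : poly_approx C f -> 0 <= e ->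
  (forall t, f t != 0 -> `|t - x| <= e) ->
  exists g, [/\ (a - x%:C%:A) * fcal C f a = g * fcal C f a, nrm g <= e &
    forall b, a * b = b * a -> g * b = b * g].
Proof.
move=> af e0 fx; pose h t := Num.max (- e) (Num.min e (t - x)).
have cst := poly_approx_cst C.
have ah : poly_approx C h.
  apply: poly_approx_max => //; apply: poly_approx_min => //.
  by apply: poly_approx_eq (poly_approx_affine C 1 (- x)) => t; rewrite mul1r.
exists (fcal C h a); split.
- rewrite -fcalM// -{1}(pevalX a) -(pevalC a) -pevalB.
  rewrite -fcal_horner -fcalM//; last exact: poly_approx_horner.
  congr (fcal C _ a); apply/funext => t; rewrite hornerXsubC /h.
  have [->|/fx] := eqVneq (f t) 0; first by rewrite !mulr0.
  by rewrite ler_norml => /andP[h1 h2]; rewrite (min_idPr h2) (max_idPr h1).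
- apply: fcal_nrm => // t _; rewrite /h ler_norml le_max lexx/= ge_max ge_min lexx/= andbT; lra.
- by move=> b; exact: fcal_comm.
Qed.
End FcalTheory.

(** * Normal elements with disjoint spectra *)

(** Each tent is the difference of two consecutive clipped ramps, so the sum telescopes. The
    variable s sends -C to 1, where ramp 0 is already saturated, and C below N, where ramp N is
    still 0. *)
Lemma tents (C e : R) : 0 <= C -> 0 < e -> exists N (f : nat -> R -> R) (c : nat -> R),
  [/\ forall j, poly_approx C (f j), forall j t, f j t != 0 -> `|t - c j| <= e &
      forall t, `|t| <= C -> \sum_(0 <= j < N) f j t = 1].
Proof.
move=> C0 e0; pose s t := e^-1 * t + (C / e + 1).
pose clip (j : nat) t := Num.max 0 (Num.min 1 (s t - j%:R)).
have cst := poly_approx_cst C.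
have aclip j : poly_approx C (clip j).
  apply: poly_approx_max => //; apply: poly_approx_min => //.
  by apply: poly_approx_eq (poly_approx_affine C e^-1 (C / e + 1 - j%:R)) => t; rewrite addrA.
pose N := Num.bound (2 * C / e + 1).
have NP : 2 * C / e + 1 < N%:R by apply: archi_boundP; rewrite addr_ge0 ?divr_ge0 ?mulr_ge0// ltW.
exists N, (fun j t => clip j t - clip j.+1 t), (fun j => j%:R * e - C); split.
- move=> j; have aN := poly_approxZ _ (-1) _ (aclip j.+1).
  apply: poly_approx_eq (poly_approxD _ _ _ (aclip j) aN) => t.
  by rewrite mulN1r.
- move=> j t; rewrite /clip -(natr1 j); set m : R := j%:R.
  have sE : s t * e = t + C + e by rewrite /s; field; rewrite gt_eqF.
  have tE : t - (m * e - C) = (s t - m - 1) * e by rewrite !mulrBl sE; ring.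
  rewrite tE normrM (gtr0_norm e0) ger_pMl// => H.
  rewrite ler_norml; apply/andP; split.
    have [h|h] := leP m (s t); first lra.
    exfalso; move/eqP: H; apply.
    by rewrite !max_l ?subrr// ge_min; apply/orP; right; lra.
  have [h|h] := leP (s t) (m + 2); first lra.
  exfalso; move/eqP: H; apply; rewrite !min_l; [|lra|lra].
  by rewrite subrr.
- move=> t; rewrite ler_norml => /andP[h1 h2]; have i0 : 0 < e^-1 by rewrite invr_gt0.
  rewrite (eq_bigr (fun j => - (clip j.+1 t - clip j t))); last by move=> j _; rewrite opprB.
  rewrite sumrN telescope_sumr// opprB /clip /s.
  set i := e^-1 in i0 NP *; set n : R := N%:R in NP *.
  have h3 : 0 <= i * (t + C) by apply: mulr_ge0; [exact: ltW|lra].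
  have h4 : 0 <= i * (C - t) by apply: mulr_ge0; [exact: ltW|lra].
  have -> : Num.min 1 (i * t + (C * i + 1) - n) = i * t + (C * i + 1) - n by apply: min_r; lra.
  rewrite min_l; last by rewrite subr0; lra.
  rewrite max_r// max_l ?subr0//; lra.
Qed.

Definition repart a : A := (2^-1)%:C *: (a + star a).
Definition impart a : A := Complex 0 (- 2^-1) *: (a - star a).

Lemma repart_selfadjoint a : selfadjoint star (repart a).
Proof. by rewrite /selfadjoint star_real (star_add cstar) (star_invol cstar) addrC. Qed.

Lemma impart_selfadjoint a : selfadjoint star (impart a).
Proof.
rewrite /selfadjoint (star_scale cstar) starB (star_invol cstar) /impart -opprB scalerN -scaleNr.
by congr (_ *: _); apply/eqP; rewrite eq_complex /= oppr0 opprK !eqxx.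
Qed.

Lemma re_im_partE a : a = repart a + Complex 0 1 *: impart a.
Proof.
rewrite /repart /impart scalerA.
have -> : Complex 0 1 * Complex 0 (- 2^-1) = (2^-1)%:C.
  by apply/eqP; rewrite eq_complex /=; apply/andP; split; apply/eqP; ring.
rewrite -scalerDr addrACA subrr addr0 scalerDr -scalerDl -rmorphD.
by rewrite (_ : 2^-1 + 2^-1 = 1 :> R) ?rmorph1 ?scale1r//; lra.
Qed.

Lemma normal_parts_comm a : normal star a -> repart a * impart a = impart a * repart a.
Proof.
move=> na; rewrite /repart /impart -!scalerAl -!scalerAr !scalerA mulrC; congr (_ *: _).
rewrite mulrDl !mulrBr na addrA subrK.
by rewrite mulrBl !mulrDr na opprD addrA addrK.
Qed.

Lemma nrm_repart a : nrm (repart a) <= nrm a.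
Proof.
rewrite nrmZr ger0_norm ?invr_ge0//.
have := nrm_triangle cstar a (star a); rewrite nrm_star; lra.
Qed.

Lemma nrm_impart a : nrm (impart a) <= nrm a.
Proof.
rewrite nrmZ /= expr0n/= add0r sqrtr_sqr normrN ger0_norm ?invr_ge0//.
have := nrm_leB a (star a); rewrite nrm_star; lra.
Qed.

(** On the product w, the real and imaginary parts of a act as those of l up to e each, so nrm ((a -
    l) w) <= 2 e nrm w. Applying b gives nrm w <= q nrm w with q < 1. *)
Lemma normal_fcal_eq0 (C e : R) a l b (f g : R -> R) :
  nrm a <= C -> normal star a -> 0 <= e -> poly_approx C f -> poly_approx C g ->
  inverse_of (a - l%:A) b -> nrm b * (2 * e) < 1 ->
  (forall t, f t != 0 -> `|t - complex.Re l| <= e) ->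
  (forall t, g t != 0 -> `|t - complex.Im l| <= e) ->
  fcal C f (repart a) * fcal C g (impart a) = 0.
Proof.
move=> aC na e0 af ag [_ ba] be fl gl; have n0 := nrm_ge0 cstar.
have sr := repart_selfadjoint a; have si := impart_selfadjoint a.
have rC := le_trans (nrm_repart a) aC; have iC := le_trans (nrm_impart a) aC.
have [G [GE Ge Gc]] := fcal_localize _ _ sr rC _ _ _ af e0 fl.
have [H [HE He Hc]] := fcal_localize _ _ si iC _ _ _ ag e0 gl.
set r := repart a in GE Gc *; set i := impart a in HE Hc *.
set F := fcal C f r in GE *; set K := fcal C g i in HE *.
(* Normality enters here: i commutes with F, so i - Im l can be moved past F to act on K. *)
have iF : i * F = F * i.
  by apply/esym/fcal_comm => //; exact: normal_parts_comm.
set w := F * K.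
have Hw : (i - (complex.Im l)%:C%:A) * w = H * w.
  have -> : (i - (complex.Im l)%:C%:A) * w = F * ((i - (complex.Im l)%:C%:A) * K).
    rewrite /w !mulrA; congr (_ * K).
    by rewrite mulrBl mulrBr iF mulr_algl mulr_algr.
  by rewrite HE mulrA -(Hc F iF) mulrA.
have Gw : (r - (complex.Re l)%:C%:A) * w = G * w by rewrite /w mulrA GE mulrA.
have wE : w = b * (G * w + Complex 0 1 *: (H * w)).
  rewrite -Gw -Hw scalerAl -mulrDl.
  have -> : r - (complex.Re l)%:C%:A + Complex 0 1 *: (i - (complex.Im l)%:C%:A) = a - l%:A.
    rewrite [in RHS](re_im_partE a) -/r -/i scalerBr addrACA -opprD; congr (_ - _).
    rewrite scalerA -scalerDl; congr (_ *: _).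
    by case: (l) => x y; apply/eqP; rewrite eq_complex /=; apply/andP; split; apply/eqP; ring.
  by rewrite mulrA ba mul1r.
have hw : nrm w <= nrm b * (2 * e) * nrm w.
  rewrite {1}wE; apply: le_trans (nrm_submult cstar _ _) _.
  rewrite -mulrA; apply: ler_wpM2l => //; apply: le_trans (nrm_triangle cstar _ _) _.
  have h1 : nrm (G * w) <= e * nrm w.
    by apply: le_trans (nrm_submult cstar _ _) _; apply: ler_wpM2r.
  have h2 : nrm (H * w) <= e * nrm w.
    by apply: le_trans (nrm_submult cstar _ _) _; apply: ler_wpM2r.
  rewrite nrmZ /= expr0n/= add0r expr1n sqrtr1 mul1r; lra.
apply: (nrm_eq0 cstar); apply/eqP; rewrite eq_le n0 andbT.
rewrite -(pmulr_lle0 (x := 1 - nrm b * (2 * e))) ?subr_gt0//; lra.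
Qed.

(** Each l lies outside one of the two spectra, where the resolvent is locally bounded; compactness
    of the square gives a common mesh e. *)
Lemma disjoint_spectra_grid (C : R) a b : spectrum a `&` spectrum b = set0 ->
  exists e, [/\ 0 < e, e <= 1 & forall l, `|complex.Re l| <= C -> `|complex.Im l| <= C ->
    exists c, (inverse_of (a - l%:A) c \/ inverse_of (b - l%:A) c) /\ nrm c * (2 * e) < 1].
Proof.
move=> dis.
pose P S := exists2 e, 0 < e & forall l, S l ->
  exists c, (inverse_of (a - l%:A) c \/ inverse_of (b - l%:A) c) /\ nrm c * (2 * e) < 1.
have n0 := nrm_ge0 cstar.
have mono c (e e' : R) : e' <= e -> nrm c * (2 * e) < 1 -> nrm c * (2 * e') < 1.
  by move=> ee' H; have := n0 c; nra.
have [e e0 HE] : P [set z | `|complex.Re z| <= C /\ `|complex.Im z| <= C].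
  apply: square_ind.
  - by exists 1.
  - by move=> S S' SS' [e e0 He]; exists e => // l /SS'; exact: He.
  - move=> S S' [e e0 He] [e' e'0 He']; exists (Num.min e e'); first by rewrite lt_min e0.
    move=> l [/He|/He'] [c [ic nc]]; exists c; split=> //; apply: mono nc; by rewrite ge_min lexx ?orbT.
  move=> l.
  have loc d c : inverse_of (d - l%:A) c -> exists2 e, 0 < e &
      forall z, normc (z - l) < e -> exists2 c', inverse_of (d - z%:A) c' & nrm c' * (2 * (e / 4)) < 1.
    move=> ic; have K0 : 0 < 1 + nrm c by rewrite ltr_pwDl.
    (* On the ball of radius e = 1/(2K) the inverses have norm at most 2K, so multiplying by 2 (e/4)
       leaves at most 1/2. *)
    set K := 1 + nrm c in K0; exists (2 * K)^-1; first by rewrite invr_gt0; lra.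
    have KE : K * (2 * K)^-1 = 2^-1 by field; rewrite gt_eqF.
    move=> z zl; have [||c' ic' nc'] := inverse_perturb _ _ (d - z%:A) K ic; first by rewrite lerDr.
      rewrite subrBB -scalerBl nrm_alg -normcN opprB -KE; apply: ler_wpM2l; exact: ltW.
    exists c' => //; have : 0 < (2 * K)^-1 by rewrite invr_gt0; lra.
    by nra.
  have : exists d c, (d = a \/ d = b) /\ inverse_of (d - l%:A) c.
    have [sa|/notin_spectrum[c ic]] := pselect (spectrum a l); last by exists a, c; split; [left|].
    have /notin_spectrum[c ic] : ~ spectrum b l.
      by move=> sb; have : (spectrum a `&` spectrum b) l by []; rewrite dis.
    by exists b, c; split; [right|].
  move=> [d [c [dE /loc[e e0 He]]]]; exists e => //.
  exists (e / 4); first by rewrite divr_gt0.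
  by move=> z /= /He[c' ic' nc']; exists c'; split=> //; case: dE => <-; [left|right].
exists (Num.min e 1); split; [by rewrite lt_min e0 ltr01|by rewrite ge_min lexx orbT|].
move=> l l1 l2; have [//|c [ic nc]] := HE l; exists c; split=> //.
by apply: mono nc; rewrite ge_min lexx.
Qed.

(** Sum the tent products over the cells where they vanish at a. The omitted products vanish at b,
    so there the sum is that of the full partition of unity. The same expression F makes sense at
    any element, hence pointwise on a function. *)
Lemma disjoint_spectra_separation (C : R) a b :
  nrm a <= C -> nrm b <= C -> normal star a -> normal star b ->
  spectrum a `&` spectrum b = set0 ->
  exists N (f : nat -> R -> R) (S : nat -> nat -> bool),
    let F c := \sum_(0 <= j < N) \sum_(0 <= k < N | S j k)
      fcal C (f j) (repart c) * fcal C (f k) (impart c) in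
    [/\ forall j, poly_approx C (f j), F a = 0 & F b = 1].
Proof.
move=> aC bC na nb dis; have C0 : 0 <= C := le_trans (nrm_ge0 cstar a) aC.
(* The margin 1 absorbs the mesh e <= 1: a tent centred beyond C + 1 vanishes on [-C, C], so only
   centres inside the larger square matter. *)
have [e [e0 e1 He]] := disjoint_spectra_grid (C + 1) _ _ dis.
have [N [f [c [af fc f1]]]] := tents _ _ C0 e0.
pose w j k x := fcal C (f j) (repart x) * fcal C (f k) (impart x).
have zero j x : selfadjoint star x -> nrm x <= C -> C + 1 < `|c j| -> fcal C (f j) x = 0.
  move=> sx xC cj; apply: (nrm_eq0 cstar); apply/eqP; rewrite eq_le (nrm_ge0 cstar) andbT.
  apply: fcal_nrm => // t /(spectrum_real_le _ _ _ xC) tC.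
  have [->|/fc h] := eqVneq (f j t) 0; first by rewrite normr0.
  exfalso; have := ler_normB t (t - c j); rewrite opprB addrC subrK; lra.
have wab j k : w j k a != 0 -> w j k b = 0.
  move=> /eqP wa.
  have [cj|cj] := leP `|c j| (C + 1); last first.
    by rewrite /w (zero j)// ?mul0r//; [exact: repart_selfadjoint|exact: le_trans (nrm_repart _) bC].
  have [ck|ck] := leP `|c k| (C + 1); last first.
    by rewrite /w (zero k) ?mulr0//; [exact: impart_selfadjoint|exact: le_trans (nrm_impart _) bC].
  have [d [[id|id] nd]] := He (Complex (c j) (c k)) cj ck.
    case: wa; apply: normal_fcal_eq0 (ltW e0) _ _ id nd _ _ => //; exact: fc.
  apply: normal_fcal_eq0 (ltW e0) _ _ id nd _ _ => //; exact: fc.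
exists N, f, (fun j k => w j k a == 0) => F; split=> //.
  by rewrite /F big1// => j _; rewrite big1// => k /eqP.
have fsum x : selfadjoint star x -> nrm x <= C -> \sum_(0 <= j < N) fcal C (f j) x = 1.
  move=> sx xC; have [H1 <-] := fcal_sum _ _ sx xC _ (index_iota 0 N) f af.
  rewrite (fcal_ext _ _ sx xC _ (horner (1 : {poly R})))//.
  - by rewrite fcal_horner// -polyC1 pevalC rmorph1 scale1r.
  - exact: poly_approx_horner.
  - by move=> t /f1 ->; rewrite hornerE.
rewrite -[RHS](mulr1 1) -{1}(fsum (repart b)); last 2 first.
- exact: repart_selfadjoint.
- exact: le_trans (nrm_repart _) bC.
rewrite -(fsum (impart b)); last 2 first.
- exact: impart_selfadjoint.
- exact: le_trans (nrm_impart _) bC.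
rewrite big_distrl/=; apply: eq_bigr => j _; rewrite big_distrr/= big_mkcond.
by apply: eq_bigr => k _; case: ifPn => // /wab.
Qed.

Lemma fcal_cst_on_spectrum (C : R) (f : R -> R) a (c : R) :
  selfadjoint star a -> nrm a <= C -> poly_approx C f ->
  (forall t : R, spectrum a t%:C -> f t = c) -> fcal C f a = c%:C%:A.
Proof.
move=> sa aC af fc; apply/eqP; rewrite -subr_eq0 -scaleNr -rmorphN.
have -> : (- c)%:C%:A = fcal C (horner (- c)%:P) a by rewrite fcal_horner// pevalC.
have ac := poly_approx_horner C (- c)%:P.
rewrite -fcalD//; apply/eqP/(nrm_eq0 cstar)/eqP; rewrite eq_le (nrm_ge0 cstar) andbT.
apply: fcal_nrm => //; first exact: poly_approxD.
by move=> t /fc ->; rewrite hornerC subrr normr0.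
Qed.

(** * Multipliers of an algebra of functions *)

(* An equivalent norm determined by the norms of selfadjoint elements. *)
Definition nrm2 a := nrm (a + star a) + nrm (a - star a).

Lemma nrm2_triangle a b : nrm2 (a + b) <= nrm2 a + nrm2 b.
Proof.
have E1 : a + b + star (a + b) = (a + star a) + (b + star b) by rewrite (star_add cstar) addrACA.
have E2 : a + b - star (a + b) = (a - star a) + (b - star b).
  by rewrite (star_add cstar) opprD addrACA.
rewrite /nrm2 E1 E2.
have := nrm_triangle cstar (a + star a) (b + star b).
have := nrm_triangle cstar (a - star a) (b - star b); lra.
Qed.

Lemma nrm2_le a : nrm2 a <= 4 * nrm a.
Proof.
rewrite /nrm2; have := nrm_triangle cstar a (star a); have := nrm_leB a (star a).
rewrite nrm_star; lra.
Qed.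

Lemma nrm_le_nrm2 a : nrm a <= nrm2 a.
Proof.
have := nrm_triangle cstar (a + star a) (a - star a).
rewrite addrACA subrr addr0 -mulr2n -scaler_nat -(rmorph_nat (real_complex R)) nrmZr /nrm2 normr_nat.
have := nrm_ge0 cstar a; lra.
Qed.

Lemma nrm2N a : nrm2 (- a) = nrm2 a.
Proof. by rewrite /nrm2 starN -!opprD !nrmN. Qed.

Lemma nrm2Zr (r : R) a : nrm2 (r%:C *: a) = `|r| * nrm2 a.
Proof. by rewrite /nrm2 star_real -scalerDr -scalerBr !nrmZr mulrDr. Qed.

Section FunctionAlgebra.
Set Implicit Arguments.
Unset Strict Implicit.
Variables (Y : topologicalType) (F : set (Y -> A)).
Implicit Types (u v w h : Y -> A) (x y z : Y).
Let n0 : forall b, 0 <= nrm b := nrm_ge0 cstar.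

Definition nrm_continuous u :=
  forall (x : Y) (e : R), 0 < e -> \forall y \near x, nrm (u y - u x) < e.

Definition unif_closure : set (Y -> A) :=
  [set u | forall e : R, 0 < e -> exists v, F v /\ forall z, nrm (v z - u z) <= e].

(** Continuous two-sided multipliers of the closure of [F]. They contain all scalar constants, even
    when [F] does not. *)
Definition multiplier : set (Y -> A) :=
  [set h | nrm_continuous h /\ forall v, F v ->
     unif_closure (fun z => h z * v z) /\ unif_closure (fun z => v z * h z)].

Hypothesis cY : compact [set: Y].
Hypothesis F0 : F (fun=> 0).
Hypothesis Fcont : forall v, F v -> nrm_continuous v.
Hypothesis FD : forall v w, F v -> F w -> F (fun z => v z + w z).
Hypothesis FZ : forall l v, F v -> F (fun z => l *: v z).
Hypothesis FM : forall v w, F v -> F w -> F (fun z => v z * w z).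
Hypothesis Fstar : forall v, F v -> F (fun z => star (v z)).

Lemma nrm_continuous_bounded u : nrm_continuous u ->
  exists2 M, 0 <= M & forall z, nrm (u z) <= M.
Proof.
move=> cu; pose P (S : set Y) := exists2 M, 0 <= M & forall z, S z -> nrm (u z) <= M.
suff [M M0 HM] : P setT by exists M => // z; exact: HM.
apply: compact_ind cY _ _ _ _.
- by exists 0.
- by move=> S S' SS' [M M0 HM]; exists M => // z /SS'; exact: HM.
- move=> S S' [M M0 HM] [M' M'0 HM']; exists (M + M'); first exact: addr_ge0.
  by move=> z [/HM|/HM']; lra.
move=> x _; exists [set y | nrm (u y - u x) < 1]; first exact: cu.
exists (nrm (u x) + 1); first by have := n0 (u x); lra.
by move=> z /=; have := nrm_dist (u z) (u x); lra.
Qed.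

Lemma nrm_continuousD u v : nrm_continuous u -> nrm_continuous v ->
  nrm_continuous (fun z => u z + v z).
Proof.
move=> cu cv x e e0; have e2 : 0 < e / 2 by lra.
apply: filterS2 (cu x _ e2) (cv x _ e2) => y h1 h2; rewrite opprD addrACA.
by have := nrm_triangle cstar (u y - u x) (v y - v x); lra.
Qed.

Lemma nrm_continuousM u v : nrm_continuous u -> nrm_continuous v ->
  nrm_continuous (fun z => u z * v z).
Proof.
move=> cu cv x e e0.
have [M M0 HM] := nrm_continuous_bounded cu; have [N N0 HN] := nrm_continuous_bounded cv.
have L0 : 0 < M + N + 1 by lra.
have d0 : 0 < e / (M + N + 1) by rewrite divr_gt0.
apply: filterS2 (cu x _ d0) (cv x _ d0) => y; rewrite !ltr_pdivlMr// => h1 h2.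
have -> : u y * v y - u x * v x = (u y - u x) * v y + u x * (v y - v x).
  by rewrite mulrBl mulrBr addrA subrK.
apply: le_lt_trans (nrm_triangle cstar _ _) _.
have := nrm_submult cstar (u y - u x) (v y); have := nrm_submult cstar (u x) (v y - v x).
have := ler_wpM2l (n0 (u y - u x)) (HN y); have := ler_wpM2r (n0 (v y - v x)) (HM x).
have := n0 (u y - u x); have := n0 (v y - v x); nra.
Qed.

Lemma nrm_continuous_star u : nrm_continuous u -> nrm_continuous (fun z => star (u z)).
Proof. by move=> cu x e e0; apply: filterS (cu x e e0) => y; rewrite -starB nrm_star. Qed.

Lemma nrm_continuous_cst a : nrm_continuous (fun=> a).
Proof. by move=> x e e0; apply: nearW => y; rewrite subrr nrm0. Qed.

Lemma nrm_continuous_lim u :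
  (forall e : R, 0 < e -> exists2 w, nrm_continuous w & forall z, nrm (w z - u z) <= e) ->
  nrm_continuous u.
Proof.
move=> H x e e0; have e4 : 0 < e / 4 by lra.
have [w cw wu] := H _ e4; apply: filterS (cw x _ e4) => y h.
have := nrm_trans (u y) (w y) (u x); have := nrm_trans (w y) (w x) (u x).
by rewrite (nrmBC (u y) (w y)); have := wu x; have := wu y; lra.
Qed.

Lemma unif_closure_sub v : F v -> unif_closure v.
Proof. by move=> Fv e e0; exists v; split=> // z; rewrite subrr nrm0 ltW. Qed.

Lemma unif_closure_lim u :
  (forall e : R, 0 < e -> exists2 w, unif_closure w & forall z, nrm (w z - u z) <= e) ->
  unif_closure u.
Proof.
move=> H e e0; have e2 : 0 < e / 2 by lra.
have [w cw wu] := H _ e2; have [v [Fv vw]] := cw _ e2; exists v; split=> // z.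
by have := nrm_trans (v z) (w z) (u z); have := wu z; have := vw z; lra.
Qed.

Lemma unif_closureD u v : unif_closure u -> unif_closure v ->
  unif_closure (fun z => u z + v z).
Proof.
move=> cu cv e e0; have e2 : 0 < e / 2 by lra.
have [u' [Fu uu']] := cu _ e2; have [v' [Fv vv']] := cv _ e2.
exists (fun z => u' z + v' z); split=> [|z]; first exact: FD.
rewrite opprD addrACA; have := nrm_triangle cstar (u' z - u z) (v' z - v z).
by have := uu' z; have := vv' z; lra.
Qed.

Lemma unif_closure_star u : unif_closure u -> unif_closure (fun z => star (u z)).
Proof.
move=> cu e e0; have [v [Fv vu]] := cu _ e0; exists (fun z => star (v z)).
by split=> [|z]; [exact: Fstar|rewrite -starB nrm_star].
Qed.

Lemma multiplierD h1 h2 : multiplier h1 -> multiplier h2 -> multiplier (fun z => h1 z + h2 z).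
Proof.
move=> [c1 m1] [c2 m2]; split; first exact: nrm_continuousD.
move=> v Fv; have [l1 r1] := m1 v Fv; have [l2 r2] := m2 v Fv.
split; [have := unif_closureD l1 l2|have := unif_closureD r1 r2]; congr unif_closure.
  by apply/funext => z; rewrite mulrDl.
by apply/funext => z; rewrite mulrDr.
Qed.

Lemma multiplierM h1 h2 : multiplier h1 -> multiplier h2 -> multiplier (fun z => h1 z * h2 z).
Proof.
move=> [c1 m1] [c2 m2]; split; first exact: nrm_continuousM.
have [M M0 HM] := nrm_continuous_bounded c1; have [N N0 HN] := nrm_continuous_bounded c2.
move=> v Fv; split; apply: unif_closure_lim => e e0.
- have [|w [Fw wv]] := (m2 v Fv).1 (e / (M + 1)); first by rewrite divr_gt0//; lra.
  exists (fun z => h1 z * w z); first exact: (m1 w Fw).1.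
  move=> z; rewrite -mulrA -mulrBr; apply: le_trans (nrm_submult cstar _ _) _.
  have := wv z; rewrite ler_pdivlMr; last lra.
  have := ler_wpM2r (n0 (w z - h2 z * v z)) (HM z); have := n0 (w z - h2 z * v z); lra.
- have [|w [Fw wv]] := (m1 v Fv).2 (e / (N + 1)); first by rewrite divr_gt0//; lra.
  exists (fun z => w z * h2 z); first exact: (m2 w Fw).2.
  move=> z; rewrite mulrA -mulrBl; apply: le_trans (nrm_submult cstar _ _) _.
  have := wv z; rewrite ler_pdivlMr; last lra.
  have := ler_wpM2l (n0 (w z - v z * h1 z)) (HN z); have := n0 (w z - v z * h1 z); lra.
Qed.

Lemma multiplier_star h : multiplier h -> multiplier (fun z => star (h z)).
Proof.
move=> [c m]; split; first exact: nrm_continuous_star.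
move=> v Fv; have [l r] := m _ (Fstar Fv).
split; [have := unif_closure_star r|have := unif_closure_star l]; congr unif_closure;
  by apply/funext => z; rewrite (star_mul cstar) (star_invol cstar).
Qed.

Lemma multiplier_sub v : F v -> multiplier v.
Proof.
by move=> Fv; split=> [|w Fw]; [exact: Fcont|split; apply: unif_closure_sub; exact: FM].
Qed.

Lemma multiplier_cst l : multiplier (fun=> l%:A).
Proof.
split=> [|v Fv]; first exact: nrm_continuous_cst.
have -> : (fun z => l%:A * v z) = (fun z => l *: v z) by apply/funext => z; rewrite mulr_algl.
have -> : (fun z => v z * l%:A) = (fun z => l *: v z) by apply/funext => z; rewrite mulr_algr.
by split; apply: unif_closure_sub; exact: FZ.
Qed.

Lemma multiplierZ l h : multiplier h -> multiplier (fun z => l *: h z).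
Proof.
move=> mh; have := multiplierM (multiplier_cst l) mh; congr multiplier.
by apply/funext => z; rewrite mulr_algl.
Qed.

Lemma multiplierB h1 h2 : multiplier h1 -> multiplier h2 -> multiplier (fun z => h1 z - h2 z).
Proof.
move=> m1 m2; have := multiplierD m1 (multiplierZ (-1) m2); congr multiplier.
by apply/funext => z; rewrite scaleN1r.
Qed.

Lemma multiplier1 : multiplier (fun=> 1).
Proof. by have := multiplier_cst 1; rewrite scale1r. Qed.

Lemma multiplier_sum (I : Type) (s : seq I) (P : pred I) (h : I -> Y -> A) :
  (forall i, multiplier (h i)) -> multiplier (fun z => \sum_(i <- s | P i) h i z).
Proof.
move=> mh; elim: s => [|i s IH].
  have := multiplier_cst 0; rewrite scale0r; congr multiplier.
  by apply/funext => z; rewrite big_nil.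
have [Pi|nPi] := boolP (P i).
  have := multiplierD (mh i) IH; congr multiplier.
  by apply/funext => z; rewrite big_cons Pi.
by have := IH; congr multiplier; apply/funext => z; rewrite big_cons (negbTE nPi).
Qed.

Lemma multiplier_lim u :
  (forall e : R, 0 < e -> exists2 w, multiplier w & forall z, nrm (w z - u z) <= e) ->
  multiplier u.
Proof.
move=> H; split.
  by apply: nrm_continuous_lim => e /H[w [cw _] wu]; exists w.
move=> v Fv; have [M M0 HM] := nrm_continuous_bounded (Fcont Fv).
have M1 : 0 < M + 1 by lra.
split; apply: unif_closure_lim => e e0;
  (have [|w [cw mw] wu] := H (e / (M + 1)); first by rewrite divr_gt0).
- exists (fun z => w z * v z); first exact: (mw v Fv).1.
  move=> z; rewrite -mulrBl; apply: le_trans (nrm_submult cstar _ _) _.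
  have := wu z; rewrite ler_pdivlMr//.
  have := ler_wpM2l (n0 (w z - u z)) (HM z); have := n0 (w z - u z); lra.
- exists (fun z => v z * w z); first exact: (mw v Fv).2.
  move=> z; rewrite -mulrBr; apply: le_trans (nrm_submult cstar _ _) _.
  have := wu z; rewrite ler_pdivlMr//.
  have := ler_wpM2r (n0 (w z - u z)) (HM z); have := n0 (w z - u z); lra.
Qed.

Lemma multiplier_peval h (p : {poly R}) : multiplier h -> multiplier (fun z => peval (h z) p).
Proof.
move=> mh; elim/poly_ind: p => [|p c IH].
  have := multiplier_cst 0; congr multiplier; apply/funext => z.
  by rewrite -polyC0 pevalC rmorph0.
have := multiplierD (multiplierM IH mh) (multiplier_cst c%:C); congr multiplier.
by apply/funext => z; rewrite pevalD pevalM pevalC pevalX.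
Qed.

Lemma multiplier_fcal (C : R) (f : R -> R) h : multiplier h ->
  (forall z, selfadjoint star (h z)) -> (forall z, nrm (h z) <= C) -> poly_approx C f ->
  multiplier (fun z => fcal C f (h z)).
Proof.
move=> mh sh hC af; apply: multiplier_lim => e e0; have [p pP] := af _ e0.
exists (fun z => peval (h z) p); first exact: multiplier_peval.
by move=> z; apply: fcalP.
Qed.

(** * Urysohn functions among the multipliers *)

Definition separated (x y : Y) := exists h, [/\ multiplier h, h x = 1 & h y = 0].

Lemma spectrally_separates_separated x y : spectrally_separates star F x y -> separated x y.
Proof.
move=> [v [Fv [nx [ny dis]]]].
have [C C0 vC] := nrm_continuous_bounded (Fcont Fv).
(* The points are swapped because the separating expression vanishes at its first argument. *)
have [N [f [S [af Fy Fx]]]] :=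
  disjoint_spectra_separation _ _ _ (vC y) (vC x) ny nx (etrans (setIC _ _) dis).
have mv := multiplier_sub Fv; have mv' := multiplier_star mv.
exists (fun z => \sum_(0 <= j < N) \sum_(0 <= k < N | S j k)
  fcal C (f j) (repart (v z)) * fcal C (f k) (impart (v z))); split; [|exact: Fx|exact: Fy].
apply: multiplier_sum => j; apply: multiplier_sum => k; apply: multiplierM.
  apply: multiplier_fcal => // [|z|z]; [|exact: repart_selfadjoint|exact: le_trans (nrm_repart _) _].
  by apply: multiplierZ; exact: multiplierD.
apply: multiplier_fcal => // [|z|z]; [|exact: impart_selfadjoint|exact: le_trans (nrm_impart _) _].
by apply: multiplierZ; exact: multiplierB.
Qed.

(** Apply to star h * h the ramp rising from 0 at 1/3 to 1 at 2/3. Approximate values 0 and 1 become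
    exact, and the norm is at most 1. *)
Lemma multiplier_sharpen h : multiplier h -> exists g, [/\ multiplier g,
  forall z, nrm (g z) <= 1,
  forall z, nrm (star (h z) * h z - 1) <= 3^-1 -> g z = 1 &
  forall z, nrm (star (h z) * h z) <= 3^-1 -> g z = 0].
Proof.
move=> mh; pose s z := star (h z) * h z.
have ms : multiplier s := multiplierM (multiplier_star mh) mh.
have ss z : selfadjoint star (s z) by rewrite /selfadjoint (star_mul cstar) (star_invol cstar).
have [C C0 sC] := nrm_continuous_bounded ms.1.
pose f t : R := Num.max 0 (Num.min 1 (3 * t - 1)).
have af : poly_approx C f.
  apply: poly_approx_max; first exact: poly_approx_cst.
  by apply: poly_approx_min; [exact: poly_approx_cst|exact: poly_approx_affine].
exists (fun z => fcal C f (s z)); split.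
- exact: multiplier_fcal.
- move=> z; apply: fcal_nrm => // t _; rewrite ger0_norm ?le_max ?lexx//.
  by rewrite /f ge_max ler01 ge_min lexx.
- move=> z hz; rewrite (fcal_cst_on_spectrum _ _ _ 1) ?rmorph1 ?scale1r// => t /(spectrum_dist _ _ 1).
  rewrite scale1r -(rmorph1 (real_complex R)) -rmorphB normc_real => /le_trans/(_ hz).
  rewrite ler_norml => /andP[h1 h2]; rewrite /f min_l ?max_r//; lra.
- move=> z hz; rewrite (fcal_cst_on_spectrum _ _ _ 0) ?rmorph0 ?scale0r// => t /spectrum_bound.
  rewrite normc_real => /le_trans/(_ hz).
  rewrite ler_norml => /andP[h1 h2]; rewrite /f max_l// ge_min; apply/orP; right; lra.
Qed.

Lemma separated_near x y : separated x y -> exists h, [/\ multiplier h,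
  \forall z \near x, h z = 1 & \forall z \near y, h z = 0].
Proof.
move=> [h [mh hx hy]]; have [g [mg _ g1 g2]] := multiplier_sharpen mh.
have [cs _] := multiplierM (multiplier_star mh) mh.
have e0 : 0 < 3^-1 :> R by rewrite invr_gt0.
exists g; split=> //.
  by apply: filterS (cs x _ e0) => z hz; apply: g1; apply: ltW; move: hz; rewrite hx star1 mulr1.
by apply: filterS (cs y _ e0) => z hz; apply: g2; apply: ltW; move: hz; rewrite hy mulr0 subr0.
Qed.

(** The usual double compactness argument: products collect zeros over K, and 1 - (1 - h)(1 - h')
    collects ones over L. Order is immaterial, since only a factor 0 or 1 matters at each point;
    sharpening restores the norm bound. *)
Lemma multiplier_urysohn (L K : set Y) : closed L -> closed K ->
  (forall x y, L x -> K y -> separated x y) ->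
  exists h, [/\ multiplier h, forall z, nrm (h z) <= 1,
    forall z, L z -> h z = 1 & forall z, K z -> h z = 0].
Proof.
move=> clL clK sep.
have cL : compact L := subclosed_compact clL cY (@subsetT _ _).
have cK : compact K := subclosed_compact clK cY (@subsetT _ _).
have H1 x : L x -> exists h, [/\ multiplier h, \forall z \near x, h z = 1 & forall z, K z -> h z = 0].
  move=> Lx.
  pose P (S : set Y) :=
    exists h, [/\ multiplier h, \forall z \near x, h z = 1 & forall z, S z -> h z = 0].
  suff : P K by [].
  apply: compact_ind cK _ _ _ _.
  - by exists (fun=> 1); split=> //; [exact: multiplier1|exact: nearW].
  - by move=> S S' SS' [h [mh hx h0]]; exists h; split=> // z /SS'; exact: h0.
  - move=> S S' [h [mh hx h0]] [h' [mh' hx' h0']]; exists (fun z => h z * h' z); split.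
    + exact: multiplierM.
    + by apply: filterS2 hx hx' => z -> ->; rewrite mulr1.
    + by move=> z [/h0|/h0'] ->; rewrite ?mul0r ?mulr0.
  move=> y Ky; have [h [mh hx hy]] := separated_near (sep x y Lx Ky).
  by exists [set z | h z = 0] => //; exists h.
pose P (S : set Y) :=
  exists h, [/\ multiplier h, forall z, S z -> h z = 1 & forall z, K z -> h z = 0].
have [h [mh hL hK]] : P L.
  apply: compact_ind cL _ _ _ _.
  - by exists (fun=> 0); split=> //; have := multiplier_cst 0; rewrite scale0r.
  - by move=> S S' SS' [h [mh h1 h0]]; exists h; split=> // z /SS'; exact: h1.
  - move=> S S' [h [mh h1 h0]] [h' [mh' h1' h0']].
    exists (fun z => 1 - (1 - h z) * (1 - h' z)); split.
    + apply: multiplierB; first exact: multiplier1.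
      by apply: multiplierM; apply: multiplierB => //; exact: multiplier1.
    + by move=> z [/h1|/h1'] ->; rewrite subrr ?mul0r ?mulr0 subr0.
    + by move=> z Kz; rewrite h0// h0'// !subr0 mulr1 subrr.
  move=> x Lx; have [h [mh hx h0]] := H1 x Lx.
  by exists [set z | h z = 1] => //; exists h.
have [g [mg g1 gL gK]] := multiplier_sharpen mh.
have e0 : 0 <= 3^-1 :> R by rewrite invr_ge0.
exists g; split=> // z Sz; first by apply: gL; rewrite hL// star1 mulr1 subrr nrm0.
by apply: gK; rewrite hK// mulr0 nrm0.
Qed.

Lemma real_continuousP (g : Y -> R) :
  (forall x (e : R), 0 < e -> \forall y \near x, `|g y - g x| < e) -> continuous g.
Proof.
move=> H x; apply/cvgrPdist_lt => e e0; apply: filterS (H x e e0) => y.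
by rewrite distrC.
Qed.

(* Slices m into n horizontal layers: outside the layer containing m z, the i-th
   Urysohn function at z is 0 or 1, so their mean is within 2/n of the scalar m z. *)
Lemma multiplier_scalar (m : Y -> R) : continuous m -> (forall z, 0 <= m z <= 1) ->
  (forall x y, m x != m y -> separated x y) -> multiplier (fun z => (m z)%:C%:A).
Proof.
move=> cm m01 sep; apply: multiplier_lim => e e0.
pose n := (Num.bound (2 / e)).+1; have n_gt0 : 0 < n%:R :> R by rewrite ltr0n.
have ne : 2 / e < n%:R.
  by apply: lt_trans (archi_boundP _) _; [rewrite divr_ge0// ltW|rewrite ltr_nat].
have /choice[h hP] : forall i : nat, exists h, [/\ multiplier h, forall z, nrm (h z) <= 1,
    forall z, i.+1%:R <= n%:R * m z -> h z = 1 & forall z, n%:R * m z <= i%:R -> h z = 0].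
  move=> i; have closed_m := (continuous_closedP m).1 cm.
  have [|||h [mh h1 hL hK]] :=
    @multiplier_urysohn (m @^-1` [set t | i.+1%:R / n%:R <= t]) (m @^-1` [set t | t <= i%:R / n%:R]).
  - by apply: closed_m; exact: closed_ge.
  - by apply: closed_m; exact: closed_le.
  - move=> x y /=; rewrite ler_pdivrMr// ler_pdivlMr// -(natr1 i) => h1 h2.
    by apply: sep; apply/eqP => E; rewrite E in h1; lra.
  exists h; split=> // z hz; first by apply: hL; rewrite /= ler_pdivrMr// mulrC.
  by apply: hK; rewrite /= ler_pdivlMr// mulrC.
exists (fun z => (n%:R^-1)%:C *: \sum_(0 <= i < n) h i z).
  by apply: multiplierZ; apply: multiplier_sum => i; have [] := hP i.
move=> z; set s := n%:R * m z.
have /andP[s0 sn] : 0 <= s <= n%:R.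
  by have /andP[mz0 mz1] := m01 z; rewrite /s mulr_ge0//= ler_piMr.
(* The share of s in layer i: 1 in a full layer, 0 in an empty one. *)
pose c (i : nat) := Num.min s i.+1%:R - Num.min s i%:R.
have sum_c : \sum_(0 <= i < n) c i = s.
  by rewrite telescope_sumr// (min_idPl sn) (min_idPr s0) subr0.
have -> : (n%:R^-1)%:C *: \sum_(0 <= i < n) h i z - (m z)%:C%:A =
    (n%:R^-1)%:C *: \sum_(0 <= i < n) (h i z - (c i)%:C%:A).
  rewrite sumrB -scaler_suml -rmorph_sum sum_c scalerBr scalerA -rmorphM /s mulrA mulVf ?mul1r//.
  by rewrite gt_eqF.
(* Full and empty layers contribute 0; the single partly filled layer contributes at most 1 + 1. *)
have partial N : (N%:R <= s -> \sum_(0 <= i < N) (h i z - (c i)%:C%:A) = 0) /\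
    nrm (\sum_(0 <= i < N) (h i z - (c i)%:C%:A)) <= 2.
  elim: N => [|N [IH0 IH2]]; first by rewrite big_nil nrm0.
  have [_ hz1 hz2 hz3] := hP N; rewrite big_nat_recr//=.
  have NE : N.+1%:R = N%:R + 1 :> R by rewrite natr1.
  have [h1|h1] := leP N.+1%:R s.
    have -> : c N = 1 by rewrite /c !min_r//; lra.
    by rewrite hz2// rmorph1 scale1r subrr addr0 IH0 ?nrm0//; lra.
  have [h2|h2] := leP s N%:R.
    have -> : c N = 0 by rewrite /c !min_l ?subrr//; lra.
    by rewrite hz3// rmorph0 scale0r subr0 addr0; split=> //; lra.
  split; first by [].
  rewrite (IH0 (ltW h2)) add0r; apply: le_trans (nrm_leB _ _) _.
  rewrite nrm_alg normc_real; have := hz1 z.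
  have -> : c N = s - N%:R by rewrite /c min_l ?min_r ?ltW.
  by rewrite ger0_norm; lra.
rewrite nrmZr ger0_norm ?invr_ge0//; have [_ h2] := partial n.
rewrite mulrC ler_pdivrMr//; apply: le_trans h2 _.
by move: ne; rewrite ltr_pdivrMr// mulrC => /ltW.
Qed.

(** * Approximation on a compact space by a partition of unity *)

Lemma stone_weierstrass_compact u : nrm_continuous u ->
  (forall x y (e : R), 0 < e ->
     exists v, [/\ F v, nrm (v x - u x) < e & nrm (v y - u y) < e]) ->
  (forall x y, spectrally_separates star F x y \/ forall v, F v -> nrm2 (v x) = nrm2 (v y)) ->
  unif_closure u.
Proof.
move=> cu Du ax.
have FB v w : F v -> F w -> F (fun z => v z - w z).
  move=> Fv Fw; have := FD Fv (FZ (-1) Fw); congr F.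
  by apply/funext => z; rewrite scaleN1r.
have cN : nrm_continuous (fun z => - u z).
  by move=> x e e0; apply: filterS (cu x e e0) => y; rewrite -opprD nrmN.
(* Distance is measured by [nrm2], the norm known to agree at unseparated points. *)
pose d v z := nrm2 (v z - u z).
have dC v : F v -> continuous (d v).
  move=> Fv; apply: real_continuousP => x e e0; have e4 : 0 < e / 4 by lra.
  have cvu : nrm_continuous (fun z => v z - u z) := nrm_continuousD (Fcont Fv) cN.
  apply: filterS (cvu x _ e4) => y.
  rewrite /d; set p := v y - u y; set q := v x - u x => pq.
  have h1 := nrm2_triangle (p - q) q; have h2 := nrm2_triangle (q - p) p.
  rewrite subrK in h1; rewrite subrK -[q - p]opprB nrm2N in h2.
  by have h3 := nrm2_le (p - q); rewrite ltr_norml; apply/andP; split; lra.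
(* Although u is not in [F], one w in [F] approximates it at both points, and [nrm2] of v - w agrees
   there. Since [nrm2] is at most 4 times [nrm], the tolerance e/8 at each point costs e in
   total. *)
have d_const x y : (forall v, F v -> nrm2 (v x) = nrm2 (v y)) ->
    forall v, F v -> d v x = d v y.
  move=> xy v Fv; apply/eqP; rewrite -subr_eq0 -normr_le0; apply/ler_addgt0Pl => e e0.
  rewrite addr0; have e8 : 0 < e / 8 by lra.
  have [w [Fw wx wy]] := Du x y _ e8.
  have h := xy _ (FB _ _ Fv Fw); rewrite /d.
  have tri z : `|nrm2 (v z - u z) - nrm2 (v z - w z)| <= 4 * nrm (w z - u z).
    have h1 := nrm2_triangle (v z - w z) (w z - u z); rewrite addrA subrK in h1.
    have h2 := nrm2_triangle (v z - u z) (u z - w z); rewrite addrA subrK in h2.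
    rewrite -[u z - w z]opprB nrm2N in h2.
    by have h3 := nrm2_le (w z - u z); rewrite ler_norml; apply/andP; split; lra.
  have := tri x; have := tri y; rewrite h !ler_norml => /andP[a1 a2] /andP[a3 a4].
  by apply/andP; split; lra.
move=> e' e'0; pose e := e' / 4; have e0 : 0 < e by rewrite /e; lra.
(* Vanishes where d v >= 2e and exceeds e where d v < e: the first bounds the final error by 2e =
   e'/2, the second keeps the denominator G at least e. *)
pose g v z := Num.max 0 (2 * e - d v z).
have g0 v z : 0 <= g v z by rewrite le_max lexx.
pose G (s : seq {v | F v}) z := \sum_(v <- s) g (sval v) z.
have G0 s z : 0 <= G s z by apply: sumr_ge0.
have [s sP] : exists s, forall z, e <= G s z.
  pose P S := exists s, forall z, S z -> e <= G s z.
  suff [s sP] : P setT by exists s => z; exact: sP.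
  apply: compact_ind cY _ _ _ _.
  - by exists [::].
  - by move=> S S' SS' [s sP]; exists s => z /SS'; exact: sP.
  - move=> S S' [s sP] [s' sP']; exists (s ++ s') => z; rewrite /G big_cat/= -!/(G _ z).
    by case=> [/sP|/sP']; have := G0 s z; have := G0 s' z; lra.
  move=> x _; have e4 : 0 < e / 4 by lra.
  have [v [Fv vx _]] := Du x x _ e4.
  exists [set y | d v y < e].
    have dx : d v x < e by rewrite /d; have := nrm2_le (v x - u x); lra.
    have d0 : 0 < e - d v x by lra.
    move/(_ x)/cvgrPdist_lt/(_ _ d0): (dC v Fv); apply: filterS => y.
    by rewrite /= distrC ltr_norml => /andP[_]; lra.
  exists [:: exist _ v Fv] => z /= dz; rewrite /G big_seq1/= /g le_max; apply/orP; right; lra.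
have gC v : F v -> continuous (g v).
  move=> Fv; apply: real_continuousP => x r r0.
  move/(_ x)/cvgrPdist_lt/(_ _ r0): (dC v Fv); apply: filterS => y.
  rewrite /= /g !ltr_norml => /andP[h1 h2].
  by have [h3|h3] := leP 0 (2 * e - d v y); have [h4|h4] := leP 0 (2 * e - d v x);
    apply/andP; split; lra.
have GC : continuous (G s).
  rewrite /G; elim: (s) => [|v r IH] x.
    by under eq_fun do rewrite big_nil; exact: cvg_cst.
  under eq_fun do rewrite big_cons.
  by apply: continuousD; [exact: gC (svalP v) x|exact: IH].
have Gp z : 0 < G s z by have := sP z; lra.
pose m v z := g v z / G s z.
have m0 v z : 0 <= m v z by rewrite divr_ge0.
have sum_m z : \sum_(v <- s) m (sval v) z = 1.
  by rewrite /m -mulr_suml -/(G s z) mulfV ?gt_eqF.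
have mult_m (v : {v | F v}) : List.In v s -> multiplier (fun z => (m (sval v) z)%:C%:A).
  move=> vs; apply: multiplier_scalar.
  - move=> x; apply: continuousM; first exact: gC (svalP v) x.
    by apply: continuousV; [rewrite gt_eqF|exact: GC].
  - move=> z; rewrite m0 ler_pdivrMr// mul1r /G.
    elim: (s) vs => [//|w r IH] /= [->|/IH h]; rewrite big_cons.
      by rewrite lerDl sumr_ge0.
    by apply: le_trans h _; rewrite lerDr.
  - move=> x y mxy; have [|xy] := ax x y; first exact: spectrally_separates_separated.
    (* All the distances d, hence the weights and G, coincide at unseparated points. *)
    exfalso; move/eqP: mxy; apply; rewrite /m /g (d_const _ _ xy _ (svalP v)); congr (_ / _).
    by apply: eq_bigr => w _; rewrite /g (d_const _ _ xy _ (svalP w)).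
pose w z := \sum_(v <- s) (m (sval v) z)%:C *: sval v z.
have cw : unif_closure w.
  rewrite /w; elim: (s) (mult_m) => [|v r IH] mr.
    by under eq_fun do rewrite big_nil; exact: unif_closure_sub.
  under eq_fun do rewrite big_cons.
  apply: unif_closureD; last by apply: IH => v' ?; apply: mr; right.
  have [_ /(_ _ (svalP v))[+ _]] := mr v (or_introl erefl).
  by under eq_fun do rewrite mulr_algl.
have wu z : nrm (w z - u z) <= e' / 2.
  apply: le_trans (nrm_le_nrm2 _) _.
  have -> : w z - u z = \sum_(v <- s) (m (sval v) z)%:C *: (sval v z - u z).
    rewrite /w -[u z in LHS]scale1r -(rmorph1 (real_complex R)) -(sum_m z) rmorph_sum scaler_suml -sumrB.
    by apply: eq_bigr => v _; rewrite scalerBr.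
  have -> : e' / 2 = \sum_(v <- s) m (sval v) z * (2 * e).
    by rewrite -mulr_suml sum_m mul1r /e; lra.
  elim: (s) => [|v r IH].
    by rewrite !big_nil; apply: le_trans (nrm2_le _) _; rewrite nrm0 mulr0.
  rewrite !big_cons; apply: le_trans (nrm2_triangle _ _) _; apply: lerD => //.
  rewrite nrm2Zr ger0_norm//; have [h|h] := leP (d (sval v) z) (2 * e).
    by apply: ler_wpM2l.
  by rewrite /m /g max_l ?mul0r//; lra.
have e2 : 0 < e' / 2 by lra.
have [v [Fv vw]] := cw _ e2; exists v; split=> // z.
by have := nrm_trans (v z) (w z) (u z); have := wu z; have := vw z; lra.
Qed.

End FunctionAlgebra.

(** * Reduction to compact spaces *)

Section OnePointExtension.
Variable X : topologicalType.
Implicit Types f g : X -> A.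

Definition one_point_ext f : one_point_compactification X -> A :=
  fun o => if o is Some x then f x else 0.

Lemma one_point_ext_continuous f : hausdorff_space X -> C0 nrm f ->
  nrm_continuous (one_point_ext f).
Proof.
move=> hX [cf vf] [x|] e e0; first exact: cf.
have [K [cK fK]] := vf e e0; exists K; first by split=> //; exact: compact_closed.
move=> _ [[x Kx <-]|->] /=; first by rewrite subr0; exact: fK.
by rewrite subrr nrm0.
Qed.
End OnePointExtension.

(** Both f + star f and i (f - star f) are selfadjoint members of E, and so are their negatives;
    [Mspec_nrm] turns equality of M into equality of their norms. *)
Lemma Mspec_nrm2 (X : Type) (E : set (X -> A)) (x y : X) :
  (forall f g, E f -> E g -> E (fun t => f t + g t)) ->
  (forall l f, E f -> E (fun t => l *: f t)) ->
  (forall f, E f -> E (fun t => star (f t))) ->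
  (forall f, E f -> (forall t, selfadjoint star (f t)) -> Mspec (f x) = Mspec (f y)) ->
  forall f, E f -> nrm2 (f x) = nrm2 (f y).
Proof.
move=> ED EZ Es EM f Ef.
have H g : E g -> (forall t, selfadjoint star (g t)) -> nrm (g x) = nrm (g y).
  move=> Eg sg; rewrite !(Mspec_nrm _ (sg _)) (EM g)//; congr Num.max.
  have := EM (fun t => -1 *: g t) (EZ _ _ Eg); rewrite !scaleN1r; apply=> t.
  by rewrite /selfadjoint scaleN1r starN sg.
congr (_ + _).
  apply: (H (fun t => f t + star (f t))); first exact: ED (Es _ Ef).
  by move=> t; rewrite /selfadjoint (star_add cstar) (star_invol cstar) addrC.
have nI a : nrm (Complex 0 1 *: a) = nrm a.
  by rewrite nrmZ /= expr0n/= add0r expr1n sqrtr1 mul1r.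
have subE t : f t - star (f t) = f t + -1 *: star (f t) by rewrite scaleN1r.
rewrite -(nI (f x - _)) -(nI (f y - _)) !subE.
apply: (H (fun t => Complex 0 1 *: (f t + -1 *: star (f t)))).
  exact: EZ (ED _ _ Ef (EZ _ _ (Es _ Ef))).
move=> t; rewrite /selfadjoint scaleN1r (star_scale cstar) starB (star_invol cstar).
rewrite -opprB scalerN -scaleNr; congr (_ *: _).
by apply/eqP; rewrite eq_complex /= oppr0 opprK !eqxx.
Qed.

End CstarTheory.

Theorem theorem2p2 (R : realType) (A : algType R[i]) (nrm : A -> R)
    (star : A -> A) (X : topologicalType) (E : set (X -> A)) :
  unital_cstar_algebra nrm star ->
  hausdorff_space X ->
  locally_compact [set: X] ->
  star_subalgebra nrm star E ->
  (* (AX0) *)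
  (~ compact [set: X] ->
     forall z : X,
       (exists f0, E f0 /\ invertible (f0 z)) \/ (forall f, E f -> f z = 0)) ->
  (* (AX1) or (AX2) for every pair of points *)
  (forall x y : X,
     spectrally_separates star E x y \/
     (forall f, E f -> (forall t, selfadjoint star (f t)) ->
        Mspec (f x) = Mspec (f y))) ->
  uniform_closure nrm E = Delta2 nrm E.
Proof.
move=> cstar hX _ [EC0 [E0 [ED [EZ [EM Es]]]]] ax0 ax12.
apply/seteqP; split=> u [C0u H]; split=> //.
  by move=> x y e /H[v [Ev vu]]; exists v; split.
have n0 : nrm 0 = 0 := nrm0 _ _ _ _ cstar.
have s0 : star 0 = 0 := star0 _ _ _ _ cstar.
have ax x y : spectrally_separates star E x y \/
    forall f, E f -> nrm2 _ _ nrm star (f x) = nrm2 _ _ nrm star (f y).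
  by have [|h] := ax12 x y; [left|right; exact: Mspec_nrm2 h].
suff : forall e : R, 0 < e -> exists v, E v /\ forall z, nrm (v z - u z) <= e.
  move=> {}H e e0; have [|v [Ev vu]] := H (e / 2); first lra.
  by exists v; split=> // z; have := vu z; lra.
have [cX|ncX] := pselect (compact [set: X]).
  apply: (@stone_weierstrass_compact _ _ nrm star cstar X E cX) => //.
  - by move=> v /EC0[].
  - exact: C0u.1.
  - by move=> x y e /(H x y)[v [Ev [vx vy]]]; exists v.
(* In the noncompact case all functions are extended by 0 to the point at infinity. *)
set Y := one_point_compactification X.
pose ext : (X -> A) -> Y -> A := @one_point_ext R A X.
pose F := [set ext f | f in E].
have extE (f : X -> A) (g : Y -> A) : (forall x, g (Some x) = f x) -> g None = 0 -> g = ext f.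
  by move=> gf gN; apply/funext => -[x|]; rewrite ?gf ?gN.
(* Spectral separation asks for normal values, so f0 is replaced by star f0 * f0, which is
   selfadjoint and still invertible at z. *)
have inv_sep (z : X) : (exists f0, E f0 /\ invertible (f0 z)) ->
    exists f, [/\ E f, selfadjoint star (f z) & invertible (f z)].
  move=> [f [Ef [g [fg gf]]]]; exists (fun t => star (f t) * f t); split.
  - exact: EM (Es _ Ef) Ef.
  - by rewrite /selfadjoint (star_mul cstar) (star_invol cstar).
  - apply: invertibleM; last by exists g.
    by exists (star g); rewrite -!(star_mul cstar) gf fg (star1 _ _ _ _ cstar).
have disj (a : A) : invertible a -> spectrum a `&` spectrum (0 : A) = set0.
  move=> ia; apply/seteqP; split=> // l [sa s0l].
  have [l0|l0] := eqVneq l 0; first by apply: sa; rewrite l0 scale0r subr0.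
  by apply: s0l; rewrite sub0r -scaleNr; apply: invertible_alg; rewrite oppr_eq0.
have normal_sa (a : A) : selfadjoint star a -> normal star a by rewrite /normal => ->.
(* (AX0) is the required dichotomy for z and infinity: the value at infinity is 0, whose spectrum
   misses that of an invertible element. *)
have axN z : spectrally_separates star F (Some z) None \/ forall f, E f -> f z = 0.
  have [/inv_sep[f [Ef sf If]]|h] := ax0 ncX z; last by right.
  left; exists (ext f); split; first by exists f.
  by split; [exact: normal_sa|split; [exact: normal_sa|exact: disj]].
have sepC (x y : Y) : spectrally_separates star F x y -> spectrally_separates star F y x.
  by move=> [f [Ff [nx [ny d]]]]; exists f; rewrite setIC.
have := @stone_weierstrass_compact _ _ nrm star cstar Y F _ _ _ _ _ _ _ (ext u).
move=> sw; have {sw} : unif_closure nrm F (ext u).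
  apply: sw.
  - exact: one_point_compactification_compact.
  - by exists (fun=> 0) => //; apply/esym/extE.
  - by move=> _ [f /EC0 C0f <-]; exact: one_point_ext_continuous cstar _ _ hX C0f.
  - move=> _ _ [f Ef <-] [g Eg <-]; exists (fun t => f t + g t); first exact: ED.
    by apply/esym/extE => //=; rewrite addr0.
  - move=> l _ [f Ef <-]; exists (fun t => l *: f t); first exact: EZ.
    by apply/esym/extE => //=; rewrite scaler0.
  - move=> _ _ [f Ef <-] [g Eg <-]; exists (fun t => f t * g t); first exact: EM.
    by apply/esym/extE => //=; rewrite mulr0.
  - move=> _ [f Ef <-]; exists (fun t => star (f t)); first exact: Es.
    by apply/esym/extE.
  - exact: one_point_ext_continuous cstar _ _ hX C0u.
  (* All extensions agree at infinity, so only finite points impose a condition. *)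
  - move=> x y e e0.
    have [v [Ev vx vy]] : exists v, [/\ E v, nrm (ext v x - ext u x) < e & nrm (ext v y - ext u y) < e].
      case: x y => [x|] [y|] /=.
      + by have [v [Ev []]] := H x y e e0; exists v.
      + by have [v [Ev []]] := H x x e e0; exists v; rewrite subrr n0.
      + by have [v [Ev []]] := H y y e e0; exists v; rewrite subrr n0.
      + by exists (fun=> 0); rewrite subrr n0.
    by exists (ext v); split=> //; exists v.
  - move=> [x|] [y|].
    + have [[f [Ef sf]]|h] := ax x y; first by left; exists (ext f); split; [exists f|].
      by right=> _ [f Ef <-]; exact: h.
    + by have [|h] := axN x; [left|right=> _ [f Ef <-] /=; rewrite h].
    + by have [/sepC|h] := axN y; [left|right=> _ [f Ef <-] /=; rewrite h].
    + by right.
move=> sw e e0; have [_ [[v Ev <-] vu]] := sw e e0.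
by exists v; split=> // z; exact: vu (Some z).
Qed.
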